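(* Let $A$ be a commutative bigraded ring (over $\mathbb{Z}$), $B$ a bigraded $\mathbb{Z}$-module, each with finite-dimensional (after $\otimes\mathbb{Q}$) homogeneous pieces in every bidegree so that $q\dim A$ and $q\dim B$ are well-defined 2-variable power series, and for each integer $k\ge 0$ let $f_k:B^{\otimes k}\to B^{\otimes (k+1)}$ be a degree preserving module homomorphism. Let $G$ be a finite graph with $n$ edges and $C(G)=C_{A,B,f_k}(G)$ the associated complex (defined in the context) for a chosen edge ordering. Then: (a) $0\to C^0(G)\xrightarrow{d^0}C^1(G)\to\cdots\xrightarrow{d^{n-1}}C^n(G)\to0$ is a chain complex of bigraded modules with degree preserving differential. (b) The cohomology groups $H^i(G)=H^i_{A,B,f_k}(G)$ are independent of the ordering of the edges, hence invariants of $G$; in fact the isomorphism type of the graded chain complex $C(G)$ is an invariant of $G$. (c) $\sum_{0\le i\le n}(-1)^i q\dim H^i(G)=\sum_{0\le i\le n}(-1)^i q\dim C^i(G)=\widehat{T}(G;\,q\dim A-1,\,q\dim B-1)$.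
   Context: Graphs are finite, loops and multiple edges allowed. For a bigraded $\mathbb{Z}$-module $M=\bigoplus_{(i,j)}M_{i,j}$, $q\dim M=\sum_{i,j}x^iy^j\dim_{\mathbb{Q}}(M_{i,j}\otimes\mathbb{Q})$. Fix an ordering $e_1,\dots,e_n$ of $E(G)$. For $s\subseteq E(G)$, $[G:s]$ is the spanning subgraph with edge set $s$, having $b_0(s)$ components and first Betti number $b_1(s)$. Set $C^s(G)=A^{\otimes b_0(s)}\otimes B^{\otimes b_1(s)}$ (one $A$ factor per component) with induced bigrading, and $C^i(G)=\bigoplus_{|s|=i}C^s(G)$. For $e_j\notin s$ the per-edge map $d_{s,j}:C^s(G)\to C^{s\cup\{e_j\}}(G)$ is: if $e_j$ joins a component of $[G:s]$ to itself, the tensor product of the identity on $A^{\otimes b_0(s)}$ with $f_k:B^{\otimes k}\to B^{\otimes k+1}$, $k=b_1(s)$; if $e_j$ joins two different components $E_1,E_2$, multiplication $A\otimes A\to A$ on the factors of $E_1,E_2$ and the identity on all other factors. The differential is $d^i=\sum_{|s|=i}\sum_{e_j\notin s}(-1)^{|\{k<j:\,e_k\in s\}|}d_{s,j}$. $\widehat{T}(G;x,y)=\sum_{s\subseteq E(G)}(-1)^{|s|}(1+x)^{b_0(s)}(1+y)^{b_1(s)}$. *)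

(* Defs.v *)
From HB Require Import structures.
From mathcomp Require Import all_boot all_order all_algebra.
From mathcomp Require Import boolp freeg ring_quotient.

Set Implicit Arguments.
Unset Strict Implicit.
Unset Printing Implicit Defensive.

Import GRing.Theory.
Local Open Scope ring_scope.
Local Open Scope quotient_scope.

Section Span.
Variable M : zmodType.

Definition span (S : M -> Prop) : {pred M} :=
  [pred x | `[< forall P : zmodClosed M, (forall y, S y -> y \in P) -> x \in P >]].

Lemma span_closed S : zmod_closed (span S).
Proof.
split=> [|x y]; first by rewrite inE; apply/asboolP => P _; exact: rpred0.
rewrite !inE => /asboolP hx /asboolP hy; apply/asboolP => P hP.
by rewrite rpredB ?hx ?hy.
Qed.

HB.instance Definition _ S := GRing.isZmodClosed.Build M (span S) (span_closed S).

Lemma span_gen (S : M -> Prop) x : S x -> x \in span S.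
Proof. by move=> Sx; rewrite inE; apply/asboolP => P; apply. Qed.

Definition zero_sub : {pred M} := pred1 0.

Lemma zero_sub_closed : zmod_closed zero_sub.
Proof.
by split=> [|x y]; rewrite !inE // => /eqP -> /eqP ->; rewrite subrr.
Qed.

HB.instance Definition _ := GRing.isZmodClosed.Build M zero_sub zero_sub_closed.

Definition subm (S : zmodClosed M) := {x : M | x \in S}.

HB.instance Definition _ (S : zmodClosed M) := SubType.copy (subm S) {x : M | x \in S}.
HB.instance Definition _ (S : zmodClosed M) := [Choice of subm S by <:].
HB.instance Definition _ (S : zmodClosed M) := [SubChoice_isSubZmodule of subm S by <:].

End Span.

Section KerIm.
Variables (M N : zmodType) (f : {additive M -> N}).

Definition ker_sub : {pred M} := [pred x | f x == 0].

Lemma ker_sub_closed : zmod_closed ker_sub.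
Proof.
split=> [|x y]; rewrite !inE ?raddf0 // raddfB => /eqP -> /eqP ->.
by rewrite subrr.
Qed.

HB.instance Definition _ := GRing.isZmodClosed.Build M ker_sub ker_sub_closed.

Definition im_sub : {pred N} := [pred y | `[< exists x, y = f x >]].

Lemma im_sub_closed : zmod_closed im_sub.
Proof.
split=> [|y1 y2]; rewrite !inE; first by apply/asboolP; exists 0; rewrite raddf0.
move=> /asboolP[x1 ->] /asboolP[x2 ->]; apply/asboolP.
by exists (x1 - x2); rewrite raddfB.
Qed.

HB.instance Definition _ := GRing.isZmodClosed.Build N im_sub im_sub_closed.

Definition preim_sub (S : zmodClosed N) : {pred M} := [pred x | f x \in S].

Lemma preim_sub_closed S : zmod_closed (preim_sub S).
Proof.
split=> [|x y]; rewrite !inE ?raddf0 ?rpred0 // raddfB => hx hy.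
exact: rpredB.
Qed.

HB.instance Definition _ S :=
  GRing.isZmodClosed.Build M (preim_sub S) (preim_sub_closed S).

Definition dirim_sub (S : zmodClosed M) : {pred N} :=
  [pred y | `[< exists2 x, x \in S & y = f x >]].

Lemma dirim_sub_closed S : zmod_closed (dirim_sub S).
Proof.
split=> [|y1 y2]; rewrite !inE.
  by apply/asboolP; exists 0; rewrite ?rpred0 ?raddf0.
move=> /asboolP[x1 S1 ->] /asboolP[x2 S2 ->]; apply/asboolP.
by exists (x1 - x2); rewrite ?rpredB ?raddfB.
Qed.

HB.instance Definition _ S :=
  GRing.isZmodClosed.Build N (dirim_sub S) (dirim_sub_closed S).

End KerIm.

Section Presented.
Variables (X : choiceType) (r : {freeg X} -> Prop).

Definition presented := Quotient.quot (span r : zmodClosed {freeg X}).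

HB.instance Definition _ := GRing.Zmodule.on presented.

Definition gen (x : X) : presented := \pi_(Quotient.quot _) << 1 *g x >>.

(* the additive extension of h, meaningful when h kills the relations r *)
Definition plift (N : zmodType) (h : X -> N) (t : presented) : N :=
  fglift (h : X -> zmodule N) (repr t).

Section Lift.
Variables (N : zmodType) (h : X -> N).
Hypothesis hr : forall w, r w -> fglift (h : X -> zmodule N) w = 0 :> N.

Local Notation fh := (fglift (h : X -> zmodule N)).

Lemma fgliftB : {morph fh : x y / x - y}.
Proof. exact: lift_is_additive. Qed.

Lemma plift_ker w : w \in span r -> fh w = 0.
Proof.
pose fa := GRing.isZmodMorphism.Build _ _ fh fgliftB.
pose fA : {additive _ -> _} := HB.pack fh fa.
rewrite inE => /asboolP/(_ (ker_sub fA)) hw; apply/eqP; apply: hw => y ry.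
by rewrite inE /= hr.
Qed.

Lemma plift_pi w : plift h (\pi_(Quotient.quot _) w) = fh w.
Proof.
rewrite /plift; apply/eqP; rewrite -subr_eq0 -fgliftB; apply/eqP/plift_ker.
by rewrite Quotient.idealrBE reprK.
Qed.

Lemma plift_gen x : plift h (gen x) = h x.
Proof. by rewrite plift_pi liftU scale1r. Qed.

Lemma plift_additive : zmod_morphism (plift h).
Proof.
move=> x y; rewrite -[x]reprK -[y]reprK -raddfB !plift_pi.
exact: fgliftB.
Qed.

End Lift.

Lemma gen_rel x y z : r (<< 1 *g x >> - << 1 *g y >> - << 1 *g z >>) ->
  gen x - gen y - gen z = 0.
Proof.
move=> rw; rewrite /gen -!raddfB.
apply: etrans (raddf0 (\pi_(Quotient.quot (span r : zmodClosed {freeg X})))).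
by apply/eqP; rewrite -Quotient.idealrBE subr0 span_gen.
Qed.

Lemma presented_ind (P : presented -> Prop) :
  P 0 -> (forall x y, P x -> P y -> P (x - y)) -> (forall x, P (gen x)) ->
  forall t, P t.
Proof.
move=> P0 PB Pg t; rewrite -[t]reprK -(freeg_sumE (repr t)) raddf_sum.
have PN x : P x -> P (- x) by move=> Px; rewrite -sub0r; exact: PB.
have PD x y : P x -> P y -> P (x + y).
  by move=> Px Py; rewrite -[y]opprK; apply: PB => //; exact: PN.
apply: (big_ind P) => // x _.
set c := coeff _ _.
have -> : << c *g x >> = << 1 *g x >> *~ c :> {freeg X}.
  by rewrite freeg_mulz -mulrzr mul1r intz.
rewrite raddfMz; have PM n : P (gen x *+ n).
  by elim: n => [|n IH]; rewrite ?mulr0n // mulrS; exact: PD.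
by case: c => n; [exact: PM | rewrite NegzE mulrNz; apply/PN/PM].
Qed.

Lemma presented_ext (N : zmodType) (f g : presented -> N) :
  zmod_morphism f -> zmod_morphism g -> (forall x, f (gen x) = g (gen x)) -> f =1 g.
Proof.
move=> fB gB fg; apply: presented_ind => [|x y fx fy|//].
  by rewrite -(subrr 0) fB gB !subrr.
by rewrite fB gB fx fy.
Qed.

End Presented.

Section Tensor.
Variables M N : zmodType.

Definition tens_rel (w : {freeg (M * N)}) : Prop :=
  (exists x y z, w = << 1 *g (x + y, z) >> - << 1 *g (x, z) >> - << 1 *g (y, z) >>) \/
  (exists x y z, w = << 1 *g (x, y + z) >> - << 1 *g (x, y) >> - << 1 *g (x, z) >>).

Definition tens := presented tens_rel.
HB.instance Definition _ := GRing.Zmodule.on tens.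

Definition tpair (x : M) (y : N) : tens := gen tens_rel (x, y).

Lemma tpairDl x y z : tpair (x + y) z = tpair x z + tpair y z.
Proof.
apply/eqP; rewrite -subr_eq0 opprD addrA; apply/eqP.
by apply: gen_rel; left; exists x, y, z.
Qed.

Lemma tpairDr x y z : tpair x (y + z) = tpair x y + tpair x z.
Proof.
apply/eqP; rewrite -subr_eq0 opprD addrA; apply/eqP.
by apply: gen_rel; right; exists x, y, z.
Qed.

Definition biadditive (P : zmodType) (h : M -> N -> P) : Prop :=
  (forall x y z, h (x + y) z = h x z + h y z) /\
  (forall x y z, h x (y + z) = h x y + h x z).

Definition tens_lift (P : zmodType) (h : M -> N -> P) : tens -> P :=
  @plift _ tens_rel P (fun u => h u.1 u.2).

Section Lift.
Variables (P : zmodType) (h : M -> N -> P).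
Hypothesis hh : biadditive h.

Lemma tens_lift_rel w : tens_rel w ->
  fglift ((fun u : M * N => h u.1 u.2) : M * N -> zmodule P) w = 0 :> P.
Proof.
case: hh => hl hr; case=> [] [x [y [z ->]]];
  rewrite !fgliftB !liftU !scale1r /= ?hl ?hr addrAC addrK;
  exact: subrr.
Qed.

Lemma tens_lift_pair x y : tens_lift h (tpair x y) = h x y.
Proof. by rewrite /tens_lift plift_gen //; exact: tens_lift_rel. Qed.

Lemma tens_lift_additive : zmod_morphism (tens_lift h).
Proof. by apply: plift_additive; exact: tens_lift_rel. Qed.

End Lift.

Lemma tens_ext (P : zmodType) (f g : tens -> P) :
  zmod_morphism f -> zmod_morphism g ->
  (forall x y, f (tpair x y) = g (tpair x y)) -> f =1 g.
Proof. by move=> fB gB fg; apply: presented_ext => // -[x y]; exact: fg. Qed.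

End Tensor.

Section TensMap.
Variables (M M' N N' : zmodType) (f : {additive M -> M'}) (g : {additive N -> N'}).

Definition tens_map : tens M N -> tens M' N' :=
  tens_lift (fun x y => tpair (f x) (g y)).

Lemma tens_map_biadditive : biadditive (fun x y => tpair (f x) (g y)).
Proof. by split=> x y z; rewrite raddfD ?tpairDl ?tpairDr. Qed.

Lemma tens_map_pair x y : tens_map (tpair x y) = tpair (f x) (g y).
Proof. exact: (tens_lift_pair tens_map_biadditive). Qed.

Lemma tens_map_additive : zmod_morphism tens_map.
Proof. exact: (tens_lift_additive tens_map_biadditive). Qed.

HB.instance Definition _ :=
  GRing.isZmodMorphism.Build (tens M N) (tens M' N') tens_map tens_map_additive.

End TensMap.

(* The tensor product of copies of M indexed by the finite type I; no ordering
   of I is involved, and for I empty it is Z. *)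
Section TensorPower.
Variables (I : finType) (M : zmodType).

Definition upd (a : {ffun I -> M}) (c : I) (x : M) : {ffun I -> M} :=
  [ffun d => if d == c then x else a d].

Definition tpow_rel (w : {freeg {ffun I -> M}}) : Prop :=
  exists a c x y,
    w = << 1 *g upd a c (x + y) >> - << 1 *g upd a c x >> - << 1 *g upd a c y >>.

Definition tpow := presented tpow_rel.
HB.instance Definition _ := GRing.Zmodule.on tpow.

Definition tpure (a : {ffun I -> M}) : tpow := gen tpow_rel a.

Lemma tpureD a c x y :
  tpure (upd a c (x + y)) = tpure (upd a c x) + tpure (upd a c y).
Proof.
apply/eqP; rewrite -subr_eq0 opprD addrA; apply/eqP.
by apply: gen_rel; exists a, c, x, y.
Qed.

Definition multiadditive (P : zmodType) (h : {ffun I -> M} -> P) : Prop :=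
  forall a c x y, h (upd a c (x + y)) = h (upd a c x) + h (upd a c y).

Definition tpow_lift (P : zmodType) (h : {ffun I -> M} -> P) : tpow -> P :=
  @plift _ tpow_rel P h.

Section Lift.
Variables (P : zmodType) (h : {ffun I -> M} -> P).
Hypothesis hh : multiadditive h.

Lemma tpow_lift_rel w : tpow_rel w ->
  fglift (h : {ffun I -> M} -> zmodule P) w = 0 :> P.
Proof.
case=> [a [c [x [y ->]]]]; rewrite !fgliftB !liftU !scale1r /= hh addrAC addrK.
exact: subrr.
Qed.

Lemma tpow_lift_pure a : tpow_lift h (tpure a) = h a.
Proof. by rewrite /tpow_lift plift_gen //; exact: tpow_lift_rel. Qed.

Lemma tpow_lift_additive : zmod_morphism (tpow_lift h).
Proof. by apply: plift_additive; exact: tpow_lift_rel. Qed.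

End Lift.

Lemma tpow_ext (P : zmodType) (f g : tpow -> P) :
  zmod_morphism f -> zmod_morphism g ->
  (forall a, f (tpure a) = g (tpure a)) -> f =1 g.
Proof. exact: presented_ext. Qed.

End TensorPower.

(* For p : I -> J, multiply together the factors lying over each j : J. *)
Section TensorMul.
Variables (A : comPzRingType) (I J : finType) (p : I -> J).

Definition fibre_prod (a : {ffun I -> A}) : {ffun J -> A} :=
  [ffun j => \prod_(i | p i == j) a i].

Definition tpow_mul : tpow I A -> tpow J A :=
  tpow_lift (fun a => tpure (fibre_prod a)).

Lemma fibre_prod_upd a c x :
  fibre_prod (upd a c x) =
  upd (fibre_prod a) (p c) (x * \prod_(i | (p i == p c) && (i != c)) a i).
Proof.
apply/ffunP => j; rewrite !ffunE; case: (eqVneq j (p c)) => [->|ne].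
  rewrite (bigD1 c) //= ffunE eqxx; congr (_ * _).
  by apply: eq_bigr => i /andP[_ /negbTE ne]; rewrite ffunE ne.
apply: eq_bigr => i /eqP pi; rewrite ffunE; case: eqP => // ic.
by rewrite -pi ic eqxx in ne.
Qed.

Lemma fibre_prod_multiadditive : multiadditive (fun a => tpure (fibre_prod a)).
Proof. by move=> a c x y; rewrite !fibre_prod_upd mulrDl tpureD. Qed.

Lemma tpow_mul_pure a : tpow_mul (tpure a) = tpure (fibre_prod a).
Proof. exact: (tpow_lift_pure fibre_prod_multiadditive). Qed.

Lemma tpow_mul_additive : zmod_morphism tpow_mul.
Proof. exact: (tpow_lift_additive fibre_prod_multiadditive). Qed.

HB.instance Definition _ :=
  GRing.isZmodMorphism.Build (tpow I A) (tpow J A) tpow_mul tpow_mul_additive.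

End TensorMul.

(* M tensor Q, with Q acting on the second factor *)
Section Rationalization.
Variable M : zmodType.

Definition rationalization := tens M rat.
HB.instance Definition _ := GRing.Zmodule.on rationalization.

Definition qscale (q : rat) : rationalization -> rationalization :=
  @tens_map M M rat rat idfun (q \*o idfun).

Lemma qscale_pair q x r : qscale q (tpair x r) = tpair x (q * r).
Proof. exact: tens_map_pair. Qed.

Lemma qscaleB q : zmod_morphism (qscale q).
Proof. exact: tens_map_additive. Qed.

Lemma qscaleA q r v : qscale q (qscale r v) = qscale (q * r) v.
Proof.
move: v; apply: tens_ext => [x y|x y|x y]; rewrite ?qscaleB //.
by rewrite !qscale_pair mulrA.
Qed.

Lemma qscale1 : left_id 1 qscale.
Proof.
by apply: tens_ext => [x y|//|x y]; rewrite ?qscaleB // qscale_pair mul1r.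
Qed.

Lemma qscaleDr : right_distributive qscale +%R.
Proof. by move=> q; exact: (raddfD (@tens_map M M rat rat idfun (q \*o idfun))). Qed.

Lemma qscaleDl v : {morph qscale^~ v : q r / q + r}.
Proof.
move=> q r; move: v; apply: tens_ext => [x y|x y|x y].
- exact: qscaleB.
- by rewrite !qscaleB opprD addrACA.
- by rewrite !qscale_pair mulrDl tpairDr.
Qed.

HB.instance Definition _ := GRing.Zmodule_isLmodule.Build rat rationalization
  qscaleA qscale1 qscaleDr qscaleDl.

End Rationalization.

Definition has_dim (K : fieldType) (V : lmodType K) (n : nat) : Prop :=
  inhabited (Vector.axiom n V).

Definition finite_dim (K : fieldType) (V : lmodType K) : Prop :=
  exists n, has_dim V n.

(* the dimension of a finite-dimensional V; 0 when V is infinite-dimensional *)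
Definition dim (K : fieldType) (V : lmodType K) : nat :=
  if pselect (finite_dim V) is left h then projT1 (cid h) else 0.

Section PowerSeries.
Variable R : comNzRingType.

Record fps := Fps { fcoef : nat -> R }.

HB.instance Definition _ := gen_eqMixin fps.
HB.instance Definition _ := gen_choiceMixin fps.

Lemma fpsP (u v : fps) : fcoef u =1 fcoef v -> u = v.
Proof. by case: u v => [u] [v] /= /funext ->. Qed.

Definition fps_add (u v : fps) := Fps (fun n => fcoef u n + fcoef v n).
Definition fps_mul (u v : fps) :=
  Fps (fun n => \sum_(i < n.+1) fcoef u i * fcoef v (n - i)%N).

Lemma fps_addA : associative fps_add.
Proof. by move=> u v w; apply: fpsP => n; exact: addrA. Qed.
Lemma fps_addC : commutative fps_add.
Proof. by move=> u v; apply: fpsP => n; exact: addrC. Qed.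
Lemma fps_add0 : left_id (Fps (fun=> 0)) fps_add.
Proof. by move=> u; apply: fpsP => n; exact: add0r. Qed.
Lemma fps_addN : left_inverse (Fps (fun=> 0)) (fun u => Fps (fun n => - fcoef u n)) fps_add.
Proof. by move=> u; apply: fpsP => n; exact: addNr. Qed.

HB.instance Definition _ := GRing.isZmodule.Build fps fps_addA fps_addC fps_add0 fps_addN.

Let trunc (N : nat) (u : fps) : {poly R} := \poly_(i < N) fcoef u i.

Let trunc_mul N u v n : (n < N)%N ->
  fcoef (fps_mul u v) n = (trunc N u * trunc N v)`_n.
Proof.
move=> ltnN; rewrite coefM; apply: eq_bigr => i _.
have lei : (i <= n)%N by rewrite -ltnS.
by rewrite !coef_poly (leq_ltn_trans lei ltnN) (leq_ltn_trans (leq_subr _ _) ltnN).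
Qed.

Let trunc_coef N u n : (n < N)%N -> (trunc N u)`_n = fcoef u n.
Proof. by move=> ltnN; rewrite coef_poly ltnN. Qed.

Let low_mul (p p' q q' : {poly R}) n :
  (forall i, (i <= n)%N -> p`_i = p'`_i) -> (forall i, (i <= n)%N -> q`_i = q'`_i) ->
  (p * q)`_n = (p' * q')`_n.
Proof.
move=> hp hq; rewrite !coefM; apply: eq_bigr => i _.
by rewrite hp 1?hq ?leq_subr -1?ltnS.
Qed.

Lemma fps_mulC : commutative fps_mul.
Proof. by move=> u v; apply: fpsP => n; rewrite !(@trunc_mul n.+1) // mulrC. Qed.

Lemma fps_mulA : associative fps_mul.
Proof.
move=> u v w; apply: fpsP => n; rewrite !(@trunc_mul n.+1) //.
rewrite (@low_mul _ (trunc n.+1 u) _ (trunc n.+1 v * trunc n.+1 w)) //; last first.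
  by move=> i lein; rewrite trunc_coef // (@trunc_mul n.+1).
rewrite mulrA; apply: low_mul => // i lein.
by rewrite trunc_coef // (@trunc_mul n.+1).
Qed.

Definition fps_one := Fps (fun n => (n == 0)%:R).

Lemma fps_mul1 : left_id fps_one fps_mul.
Proof.
move=> u; apply: fpsP => n /=; rewrite big_ord_recl /= mul1r subn0 big1 ?addr0 //.
by move=> i _; rewrite mul0r.
Qed.

Lemma fps_mulDl : left_distributive fps_mul +%R.
Proof.
move=> u v w; apply: fpsP => n /=; rewrite -big_split /=.
by apply: eq_bigr => i _; rewrite mulrDl.
Qed.

Lemma fps_one_neq0 : fps_one != 0.
Proof.
by apply/eqP => /(congr1 (fcoef^~ 0%N)) /= /eqP; rewrite oner_eq0.
Qed.

HB.instance Definition _ := GRing.Zmodule_isComNzRing.Build fps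
  fps_mulA fps_mulC fps_mul1 fps_mulDl fps_one_neq0.

End PowerSeries.

(* Bidegrees are pairs of natural numbers, so that q-dimensions are power series
   and products of them make sense. *)
Definition bigrading (M : zmodType) := nat -> nat -> zmodClosed M.

(* M is the internal direct sum of the pieces of g *)
Definition is_bigraded (M : zmodType) (g : bigrading M) : Prop :=
  (forall x : M, exists (N : nat) (h : nat -> nat -> M),
     (forall i j, h i j \in g i j) /\ x = \sum_(i < N) \sum_(j < N) h i j) /\
  (forall (N : nat) (h : nat -> nat -> M), (forall i j, h i j \in g i j) ->
     \sum_(i < N) \sum_(j < N) h i j = 0 ->
     forall i j, (i < N)%N -> (j < N)%N -> h i j = 0).

Definition is_bigraded_ring (A : comPzRingType) (g : bigrading A) : Prop :=
  is_bigraded g /\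
  forall i j k l a b, a \in g i j -> b \in g k l -> a * b \in g (i + k)%N (j + l)%N.

Definition degree_preserving (M N : zmodType) (g : bigrading M) (g' : bigrading N)
  (f : M -> N) : Prop := forall i j x, x \in g i j -> f x \in g' i j.

Definition bigraded_iso (M N : zmodType) (g : bigrading M) (g' : bigrading N)
  (f : {additive M -> N}) : Prop :=
  bijective f /\ forall i j x, (f x \in g' i j) = (x \in g i j).

Definition bigraded_isomorphic (M N : zmodType) (g : bigrading M) (g' : bigrading N) :
  Prop := exists phi : {additive M -> N}, bigraded_iso g g' phi.

Definition qfinite (M : zmodType) (g : bigrading M) : Prop :=
  forall i j, finite_dim (rationalization (subm (g i j))).

(* a power series in Z[[x, y]], seen as Z[[y]][[x]] *)
Definition qdim (M : zmodType) (g : bigrading M) : fps (fps int) :=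
  Fps (fun i => Fps (fun j => (dim (rationalization (subm (g i j))))%:Z)).

Section InducedGradings.

Definition subm_gr (M : zmodType) (S : zmodClosed M) (g : bigrading M) :
  bigrading (subm S) := fun i j => preim_sub (val : subm S -> M) (g i j).

Definition quot_gr (M : zmodType) (S : zmodClosed M) (g : bigrading M) :
  bigrading (Quotient.quot S) :=
  fun i j => dirim_sub (\pi_(Quotient.quot S)) (g i j).

Definition tens_gr (M N : zmodType) (g : bigrading M) (g' : bigrading N) :
  bigrading (tens M N) :=
  fun i j => span (fun t => exists i1 j1 i2 j2 x y,
    [/\ x \in g i1 j1, y \in g' i2 j2, (i1 + i2 = i)%N, (j1 + j2 = j)%N
      & t = tpair x y]).

Definition tpow_gr (I : finType) (M : zmodType) (g : bigrading M) :
  bigrading (tpow I M) :=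
  fun i j => span (fun t => exists (p q : I -> nat) (a : {ffun I -> M}),
    [/\ forall c, a c \in g (p c) (q c), (\sum_c p c = i)%N, (\sum_c q c = j)%N
      & t = tpure a]).

End InducedGradings.

Section DirectSum.
Variables (I : finType) (M : I -> zmodType).

(* I is finite, so this is both the product and the direct sum of the M i. *)
Definition dsum : Type := forall i, M i.

HB.instance Definition _ := gen_eqMixin dsum.
HB.instance Definition _ := gen_choiceMixin dsum.

Lemma dsum_addA : associative (fun (x y : dsum) i => x i + y i).
Proof. by move=> x y z; apply: functional_extensionality_dep => i; exact: addrA. Qed.
Lemma dsum_addC : commutative (fun (x y : dsum) i => x i + y i).
Proof. by move=> x y; apply: functional_extensionality_dep => i; exact: addrC. Qed.
Lemma dsum_add0 : left_id ((fun=> 0) : dsum) (fun (x y : dsum) i => x i + y i).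
Proof. by move=> x; apply: functional_extensionality_dep => i; exact: add0r. Qed.
Lemma dsum_addN : left_inverse ((fun=> 0) : dsum) (fun (x : dsum) i => - x i)
  (fun (x y : dsum) i => x i + y i).
Proof. by move=> x; apply: functional_extensionality_dep => i; exact: addNr. Qed.

HB.instance Definition _ :=
  GRing.isZmodule.Build dsum dsum_addA dsum_addC dsum_add0 dsum_addN.

Variable g : forall i, bigrading (M i).

Definition dsum_piece (a b : nat) : {pred dsum} := [pred x : dsum | [forall i, x i \in g i a b]].

Lemma dsum_piece_closed a b : zmod_closed (dsum_piece a b).
Proof.
split=> [|x y]; rewrite !inE; first by apply/forallP => i; exact: rpred0.
by move=> /forallP hx /forallP hy; apply/forallP => i; apply: rpredB.
Qed.

HB.instance Definition _ a b :=
  GRing.isZmodClosed.Build dsum (dsum_piece a b) (dsum_piece_closed a b).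

Definition dsum_gr : bigrading dsum := fun a b => dsum_piece a b.

End DirectSum.

(* the identity F i -> F j when i = j, and the zero map otherwise *)
Section Transport.
Variables (I : eqType) (F : I -> zmodType).

Definition transport (i j : I) (x : F i) : F j :=
  if i =P j is ReflectT e then ecast k (F k) e x else 0.

Lemma transport_id i x : transport i x = x.
Proof. by rewrite /transport; case: eqP => // e; rewrite eq_axiomK. Qed.

Lemma transport_additive i j : zmod_morphism (@transport i j).
Proof.
move=> x y; rewrite /transport; case: eqP => [e|_]; last by rewrite subrr.
by case: _ / e.
Qed.

HB.instance Definition _ i j := GRing.isZmodMorphism.Build (F i) (F j)
  (@transport i j) (@transport_additive i j).

End Transport.

Arguments transport {I} F {i} j x.
Arguments transport_id {I} F {i} x.

Record precomplex := Precomplex {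
  cobj : nat -> zmodType;
  cgr : forall i, bigrading (cobj i);
  cdif : forall i, {additive cobj i -> cobj i.+1} }.

Definition bigraded_complex (K : precomplex) : Prop :=
  [/\ forall i, is_bigraded (@cgr K i),
      forall i, degree_preserving (@cgr K i) (@cgr K i.+1) (@cdif K i)
    & forall i x, @cdif K i.+1 (@cdif K i x) = 0].

Definition complex_iso (K L : precomplex) : Prop :=
  exists phi : forall i, {additive cobj K i -> cobj L i},
    (forall i, bigraded_iso (@cgr K i) (@cgr L i) (phi i)) /\
    (forall i x, phi i.+1 (cdif K i x) = cdif L i (phi i x)).

Section Cohomology.
Variable K : precomplex.

Definition cocycles (i : nat) := subm (ker_sub (cdif K i)).

Definition coboundaries (i : nat) : zmodClosed (cobj K i) :=
  match i with
  | 0 => @zero_sub (cobj K 0)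
  | i'.+1 => im_sub (cdif K i')
  end.

Definition cohomology (i : nat) : zmodType :=
  Quotient.quot (preim_sub (val : cocycles i -> cobj K i) (coboundaries i)).

Definition cohomology_gr (i : nat) : bigrading (cohomology i) :=
  quot_gr _ (subm_gr _ (@cgr K i)).

End Cohomology.

(* Loops and multiple edges are allowed. Each edge carries an orientation from
   src to tgt, which only serves to write down the boundary map. *)
Record mgraph := Mgraph {
  vertex : finType;
  edge : finType;
  src : edge -> vertex;
  tgt : edge -> vertex }.

Definition mgraph_iso (G H : mgraph) : Prop :=
  exists (phi : vertex G -> vertex H) (psi : edge G -> edge H),
    [/\ bijective phi, bijective psi
      & forall e, (src (psi e) = phi (src e) /\ tgt (psi e) = phi (tgt e)) \/
                  (src (psi e) = phi (tgt e) /\ tgt (psi e) = phi (src e))].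

Section SpanningSubgraph.
Variables (G : mgraph) (s : {set edge G}).

Definition adj : rel (vertex G) :=
  [rel u v | [exists e in s, ((src e == u) && (tgt e == v)) ||
                             ((src e == v) && (tgt e == u))]].

Lemma adj_sym : symmetric adj.
Proof. by move=> u v; apply: eq_existsb => e; rewrite orbC. Qed.

Definition b0 : nat := n_comp adj (vertex G).

(* the components of [G:s], each given by its canonical root *)
Definition component : finType := {v : vertex G | roots adj v}.

Lemma card_component : #|{: component}| = b0.
Proof.
by rewrite card_sig /b0 /n_comp_mem; apply: eq_card => v; rewrite !inE andbT.
Qed.

(* the component of a vertex *)
Definition comp_of (v : vertex G) : component :=
  exist (roots adj) (fingraph.root adj v) (roots_root (sym_connect_sym adj_sym) v).

Definition joins_itself (e : edge G) : bool := comp_of (src e) == comp_of (tgt e).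

Definition boundary1 (e : edge G) : 'rV[rat]_#|vertex G| :=
  \row_v ((tgt e == enum_val v)%:R - (src e == enum_val v)%:R).

(* the simplicial boundary C_1 -> C_0 of [G:s] with rational coefficients *)
Definition boundary : 'M[rat]_(#|s|, #|vertex G|) :=
  \matrix_(i < #|s|) boundary1 (enum_val i).

(* the dimension of H_1([G:s]; Q) *)
Definition b1 : nat := \rank (kermx boundary).

End SpanningSubgraph.

Section AddEdge.
Variables (G : mgraph) (s : {set edge G}) (e : edge G).

Lemma joins_itselfE : joins_itself s e = connect (adj s) (src e) (tgt e).
Proof. by rewrite /joins_itself -(inj_eq val_inj) /= root_connect //; exact/sym_connect_sym/adj_sym. Qed.

Lemma boundary_eqmx (t : {set edge G}) : (boundary t :=: \sum_(f in t) <<boundary1 f>>)%MS.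
Proof.
apply/eqmxP/andP; split.
  apply/row_subP => i; rewrite rowK (sumsmx_sup (enum_val i)) ?enum_valP //.
  by rewrite genmxE.
apply/sumsmx_subP => f tf; rewrite genmxE.
have -> : boundary1 f = row (enum_rank_in tf f) (boundary t).
  by rewrite rowK enum_rankK_in.
exact: row_sub.
Qed.

Let diff_row (u v : vertex G) : 'rV[rat]_#|vertex G| :=
  \row_x ((v == enum_val x)%:R - (u == enum_val x)%:R).

Lemma boundary_connect u v : connect (adj s) u v -> (diff_row u v <= boundary s)%MS.
Proof.
case/connectP => p + ->; elim: p u => [|w p IH] u /=.
  by move=> _; rewrite (_ : diff_row _ _ = 0) ?sub0mx //; apply/rowP => x; rewrite !mxE subrr.
case/andP => /existsP[f /andP[sf uw]] /IH le.
rewrite (_ : diff_row _ _ = diff_row w (last w p) + diff_row u w); last first.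
  by apply/rowP => x; rewrite !mxE subrKA.
apply: addmx_sub => //; rewrite boundary_eqmx.
apply: (sumsmx_sup f) => //; rewrite genmxE.
case/orP: uw => /andP[/eqP <- /eqP <-]; first exact: submx_refl.
rewrite -eqmx_opp (_ : - _ = boundary1 f) ?submx_refl //.
by apply/rowP => x; rewrite !mxE opprB.
Qed.

Lemma boundary1_disconnect : ~~ joins_itself s e -> ~~ (boundary1 e <= boundary s)%MS.
Proof.
rewrite joins_itselfE => ne; apply/negP => /submxP[D eD].
pose c : 'cV[rat]_#|vertex G| := \col_x (connect (adj s) (src e) (enum_val x))%:R.
have bc f : boundary1 f *m c = (connect (adj s) (src e) (tgt f))%:R%:M
    - (connect (adj s) (src e) (src f))%:R%:M :> 'M_1.
  have ev w : \sum_x (w == enum_val x)%:R * c x 0 = (connect (adj s) (src e) w)%:R.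
    rewrite (bigD1 (enum_rank w)) //= mxE enum_rankK eqxx mul1r big1 ?addr0 //.
    move=> x; case: (w =P enum_val x) => [->|_ _]; last by rewrite mul0r.
    by rewrite enum_valK eqxx.
  apply/matrixP => i j; rewrite !ord1 !mxE eqxx !mulr1n -!ev -sumrB.
  by apply: eq_bigr => x _; rewrite !mxE mulrBl.
have := congr1 (fun u => u *m c) eD.
rewrite -mulmxA (_ : boundary s *m c = 0) ?mulmx0.
  rewrite bc connect0 (negbTE ne) => /matrixP/(_ 0 0) /eqP.
  by rewrite !mxE eqxx sub0r oppr_eq0 oner_eq0.
apply/row_matrixP => i; rewrite row_mul rowK bc row0.
set f := enum_val i; have sf : f \in s := enum_valP i.
suff -> : connect (adj s) (src e) (tgt f) = connect (adj s) (src e) (src f).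
  by rewrite subrr.
apply/esym/same_connect_r; first exact/sym_connect_sym/adj_sym.
by apply: connect1; apply/existsP; exists f; rewrite sf !eqxx.
Qed.

Hypothesis ses : e \notin s.

Lemma b1E (t : {set edge G}) : (b1 t + \rank (boundary t) = #|t|)%N.
Proof. by rewrite /b1 mxrank_ker subnK ?rank_leq_row. Qed.

Lemma boundary_add : (boundary (e |: s) :=: boundary1 e + boundary s)%MS.
Proof.
apply: eqmx_trans (boundary_eqmx _) _; rewrite big_setU1 //=.
by apply: adds_eqmx; [exact: genmxE | exact/eqmx_sym/boundary_eqmx].
Qed.

Lemma b1_self : joins_itself s e -> b1 (e |: s) = (b1 s).+1.
Proof.
rewrite joins_itselfE => /boundary_connect le.
apply: (@addIn (\rank (boundary (e |: s)))); rewrite b1E boundary_add.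
by rewrite (addsmx_idPr le) addSn b1E cardsU1 ses.
Qed.

Lemma b1_join : ~~ joins_itself s e -> b1 (e |: s) = b1 s.
Proof.
move=> /boundary1_disconnect nle.
apply: (@addIn (\rank (boundary (e |: s)))); rewrite b1E boundary_add.
have -> : \rank (boundary1 e + boundary s)%MS = (\rank (boundary s)).+1.
  apply/eqP; rewrite eqn_leq; apply/andP; split.
    rewrite (leq_trans (mxrank_adds_leqif _ _)) // -[X in (_ <= X)%N]add1n leq_add2r.
    exact: rank_leq_row.
  rewrite ltnNge; apply/negP => le; case/negP: nle.
  have := mxrank_leqif_sup (addsmxSr (boundary1 e) (boundary s)).
  case=> le2 eqr; move: eqr; rewrite eqn_leq le le2 => /esym.
  by rewrite addsmx_sub => /andP[].
by rewrite addnS b1E cardsU1 ses.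
Qed.

End AddEdge.

Section Complex.
Variables (A : comPzRingType) (gA : bigrading A) (B : zmodType) (gB : bigrading B).
Variable f : forall k : nat, {additive tpow 'I_k B -> tpow 'I_k.+1 B}.
Variables (G : mgraph) (n : nat) (e : 'I_n -> edge G).

Definition state (s : {set edge G}) : zmodType :=
  tens (tpow (component s) A) (tpow 'I_(b1 s) B).

Definition state_gr (s : {set edge G}) : bigrading (state s) :=
  tens_gr (tpow_gr (component s) gA) (tpow_gr 'I_(b1 s) gB).

(* each component of [G:s] is sent to the component of [G:t] containing it *)
Definition component_map (s t : {set edge G}) (c : component s) : component t :=
  comp_of t (val c).

(* By b1_self and b1_join the transports below are along equalities of
   exponents whenever a is not in s. *)
Definition B_map (s : {set edge G}) (a : edge G) :
    tpow 'I_(b1 s) B -> tpow 'I_(b1 (a |: s)) B :=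
  if joins_itself s a
  then fun x => transport (fun k => tpow 'I_k B : zmodType) (b1 (a |: s)) (f (b1 s) x)
  else fun x => transport (fun k => tpow 'I_k B : zmodType) (b1 (a |: s)) x.

Lemma B_map_additive s a : zmod_morphism (@B_map s a).
Proof. by move=> x y; rewrite /B_map; case: ifP => _; rewrite !raddfB. Qed.

HB.instance Definition _ s a := GRing.isZmodMorphism.Build
  (tpow 'I_(b1 s) B) (tpow 'I_(b1 (a |: s)) B) (@B_map s a) (@B_map_additive s a).

(* On the A factors: when a joins a component to itself, component_map is a
   bijection and the factors are unchanged; otherwise its only fibre with more
   than one element consists of the two components joined by a. *)
Definition edge_map (s : {set edge G}) (a : edge G) : state s -> state (a |: s) :=
  tens_map (tpow_mul (@component_map s (a |: s))) (@B_map s a).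

HB.instance Definition _ s a :=
  GRing.isZmodMorphism.Build (state s) (state (a |: s)) (@edge_map s a)
    (@tens_map_additive _ _ _ _ _ _).

Definition states (i : nat) : finType := {s : {set edge G} | #|s| == i}.

Definition chain (i : nat) : zmodType := dsum (fun s : states i => state (val s)).

Definition chain_gr (i : nat) : bigrading (chain i) :=
  dsum_gr (fun s : states i => state_gr (val s)).

(* the inclusion of the summand C^t(G) in C^i(G), for #|t| = i *)
Definition incl (i : nat) (t : {set edge G}) (y : state t) : chain i :=
  fun u => transport state (val u) y.

(* the number of edges of s that precede e j *)
Definition sign_exp (s : {set edge G}) (j : 'I_n) : nat :=
  #|[set k : 'I_n | (k < j)%N && (e k \in s)]|.

Definition differential (i : nat) (x : chain i) : chain i.+1 :=
  \sum_(s : states i) \sum_(j < n | e j \notin val s)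
    @incl i.+1 (e j |: val s) (edge_map (e j) (x s)) *~ (-1) ^+ sign_exp (val s) j.

Lemma incl_additive i t : zmod_morphism (@incl i t).
Proof.
by move=> x y; apply: functional_extensionality_dep => u; rewrite /incl raddfB.
Qed.

Lemma differential_additive i : zmod_morphism (@differential i).
Proof.
move=> x y; rewrite /differential -[RHS]sumrB; apply: eq_bigr => s _.
rewrite -[RHS]sumrB; apply: eq_bigr => j _.
have -> : (x - y : chain i) s = x s - y s by [].
by rewrite raddfB incl_additive mulrzBl.
Qed.

HB.instance Definition _ i := GRing.isZmodMorphism.Build (chain i) (chain i.+1)
  (@differential i) (@differential_additive i).

Definition tutte_complex : precomplex :=
  Precomplex chain_gr (fun i => @differential i : {additive chain i -> chain i.+1}).

End Complex.

Definition That (G : mgraph) (R : comPzRingType) (x y : R) : R :=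
  \sum_(s : {set edge G}) (-1) ^+ #|s| * (1 + x) ^+ b0 s * (1 + y) ^+ b1 s.

(* Main.v *)
(* Everything is reduced to ranks of abelian groups: M tensor Q has dimension n
   if and only if M has a Z-independent family of n elements of which every
   element is a rational combination, because x tensor 1 vanishes only when x is
   torsion. Rank is additive along homomorphisms, so in each bidegree the
   alternating sums of the ranks of chains and of cohomology agree. A bigraded
   group has additive projections onto its pieces; these split tensor products
   bidegree by bidegree, so q-dimension is multiplicative, and (c) follows by
   summing over the subsets of edges.
   The square of the differential vanishes because the maps of two edges commute
   (on the B factors both composites iterate f the same number of times, namely
   the increase of b1), while the signs of the two orders are opposite. A change
   of the edge ordering is absorbed by multiplying C^s by (-1) to the number of
   pairs in s whose order is inverted. *)
From HB Require Import structures.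
Require Import Defs.
From mathcomp Require Import all_boot all_order all_algebra.
From mathcomp Require Import boolp freeg ring_quotient.

Set Implicit Arguments.
Unset Strict Implicit.
Unset Printing Implicit Defensive.

Import GRing.Theory Num.Theory.
Local Open Scope ring_scope.
Local Open Scope quotient_scope.

(** * Rank of abelian groups *)

(** Tensor products are quotients of free groups, so nothing about an element can be read off a
    representative: that it is nonzero has to be detected by an additive map defined on the whole
    product. Independence of the tensors of two bases is therefore tested against products of
    coordinate functionals. A coordinate functional is available only on one homogeneous piece, and
    the graded projections extend it to the whole module; this is why [is_bigraded] is first turned
    into projections. Ranks are attached to subgroups of a fixed ambient group, so that pieces,
    kernels and images can be compared without changing type.

    The second obstacle is dependent typing. The group of a spanning subgraph depends on the edge
    set, and equal edge sets or equal Betti numbers give types that are not convertible. [transport]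
    bridges them, and pairing an element with its exponent removes it again where composites are
    compared.

    Reordering the edges and replacing the graph by an isomorphic one are handled by the same chain
    map: a reordering is the identity isomorphism between two orderings of one graph. *)

Definition zadd (M N : zmodType) (f : M -> N) (fB : zmod_morphism f) :
    {additive M -> N} :=
  HB.pack f (GRing.isZmodMorphism.Build M N f fB).

Section TensorArith.
Variables M N : zmodType.

Lemma tpairBl (x y : M) (z : N) : tpair (x - y) z = tpair x z - tpair y z.
Proof. by apply/eqP; rewrite eq_sym subr_eq -tpairDl subrK. Qed.

Lemma tpairBr (x : M) (y z : N) : tpair x (y - z) = tpair x y - tpair x z.
Proof. by apply/eqP; rewrite eq_sym subr_eq -tpairDr subrK. Qed.

Definition tpairl (z : N) : {additive M -> tens M N} :=
  zadd (fun x y : M => tpairBl x y z).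

Definition tpairr (x : M) : {additive N -> tens M N} := zadd (tpairBr x).

Lemma tpair0l (z : N) : tpair (0 : M) z = 0.
Proof. exact: (raddf0 (tpairl z)). Qed.

Lemma tpair0r (x : M) : tpair x (0 : N) = 0.
Proof. exact: (raddf0 (tpairr x)). Qed.

Lemma tpairMzl (x : M) (z : N) k : tpair (x *~ k) z = tpair x z *~ k.
Proof. exact: (raddfMz (tpairl z)). Qed.

Lemma tpairMzr (x : M) (z : N) k : tpair x (z *~ k) = tpair x z *~ k.
Proof. exact: (raddfMz (tpairr x)). Qed.

Lemma tpair_suml I r (P : pred I) (F : I -> M) (z : N) :
  tpair (\sum_(i <- r | P i) F i) z = \sum_(i <- r | P i) tpair (F i) z.
Proof. exact: (raddf_sum (tpairl z)). Qed.

Lemma tpair_sumr I r (P : pred I) (x : M) (F : I -> N) :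
  tpair x (\sum_(i <- r | P i) F i) = \sum_(i <- r | P i) tpair x (F i).
Proof. exact: (raddf_sum (tpairr x)). Qed.

Lemma tens_ind (P : tens M N -> Prop) :
  P 0 -> (forall x y, P x -> P y -> P (x - y)) -> (forall x y, P (tpair x y)) ->
  forall t, P t.
Proof. by move=> P0 PB Pg; apply: presented_ind => // -[x y]; exact: Pg. Qed.

End TensorArith.

Section Torsion.
Variable M : zmodType.

(** Models multiplication by [D] on M tensor Q with values back in M. It is meaningful only when
    [u.2 * D] is an integer, where [numq] returns that integer; otherwise the numerator is a junk
    value. *)
Definition clear_denom (D : int) (u : M * rat) : zmodule M :=
  u.1 *~ numq (u.2 * D%:~R).

(* Quantifying over all multiples of D makes this a subgroup; it contains the
   relations of M tensor Q, because for D divisible enough clear_denom D is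
   biadditive on the finitely many pairs involved. *)
Definition eventually_killed : {pred {freeg (M * rat)}} :=
  [pred w | `[< exists2 D : int, D != 0 &
                forall D', fglift (clear_denom (D * D')) w = 0 >]].

Lemma eventually_killed_closed : zmod_closed eventually_killed.
Proof.
split=> [|v w]; rewrite !inE.
  by apply/asboolP; exists 1 => // D'; rewrite -(subrr 0) fgliftB subrr.
move=> /asboolP[D D0 hD] /asboolP[E E0 hE]; apply/asboolP.
exists (D * E) => [|D']; first by rewrite mulf_neq0.
by rewrite fgliftB -{1}mulrA hD -mulrA mulrCA hE subrr.
Qed.

HB.instance Definition _ :=
  GRing.isZmodClosed.Build _ eventually_killed eventually_killed_closed.

(** For sums in M the rational factor is shared, so [clear_denom] is additive for every [D] and the
    witness is 1. For sums in Q both rationals must first become integers, which any multiple of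
    [denq y * denq z] ensures. *)
Lemma tens_rel_killed w : @tens_rel M rat w -> w \in eventually_killed.
Proof.
move=> [] [x [y [z ->]]]; rewrite inE; apply/asboolP.
  exists 1 => // D'; rewrite !fgliftB !liftU !scale1r /clear_denom /=.
  by rewrite mulrzDl addrAC addrK subrr.
exists (denq y * denq z) => [|D']; first by rewrite mulf_neq0 ?denq_neq0.
have ey : y * (denq y * denq z * D')%:~R = (numq y * denq z * D')%:~R.
  by rewrite -{1}[y]divq_num_den -mulrA !intrM !mulrA mulfVK // intr_eq0 denq_neq0.
have ez : z * (denq y * denq z * D')%:~R = (numq z * denq y * D')%:~R.
  rewrite -{1}[z]divq_num_den [denq y * _]mulrC -mulrA !intrM !mulrA mulfVK //.
  by rewrite intr_eq0 denq_neq0.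
rewrite !fgliftB !liftU !scale1r /clear_denom /= mulrDl ey ez -intrD !numq_int.
by rewrite mulrzDr addrAC addrK subrr.
Qed.

Lemma tpair1_eq0 (x : M) : tpair x (1 : rat) = 0 -> exists2 m : int, m != 0 & x *~ m = 0.
Proof.
move=> x0.
have : << 1 *g (x, 1 : rat) >> \in Defs.span (@tens_rel M rat).
  rewrite -[X in X \in _]subr0 Quotient.idealrBE; apply/eqP/(etrans x0).
  pose rQ := Defs.span (@tens_rel M rat) : zmodClosed {freeg (M * rat)}.
  by rewrite (raddf0 (\pi_(Quotient.quot rQ))).
rewrite inE => /asboolP/(_ eventually_killed)/(_ tens_rel_killed).
(* At [D' = 1] the rational factor is the integer [D] itself, so the generator (x, 1) is sent to
   [x *~ D], and this is 0. *)
rewrite inE => /asboolP[D D0 /(_ 1)]; rewrite liftU scale1r /clear_denom /=.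
by rewrite mulr1 mul1r numq_int; exists D.
Qed.

Lemma tpair_invM (x : M) (d e : int) : e != 0 ->
  tpair x (d%:~R^-1 : rat) = tpair (x *~ e) ((d * e)%:~R^-1 : rat).
Proof.
move=> e0; have e0' : e%:~R != 0 :> rat by rewrite intr_eq0.
rewrite tpairMzl -[RHS]tpairMzr; congr tpair.
by rewrite -[RHS]mulrzr intrM invfM mulfVK.
Qed.

Lemma rationalizationP (w : rationalization M) :
  exists x : M, exists2 d : int, d != 0 & w = tpair x d%:~R^-1.
Proof.
move: w; apply: tens_ind => [|_ _ [x [d d0 ->]] [y [e e0 ->]]|x q].
- by exists 0, 1; rewrite ?tpair0l.
- exists (x *~ e - y *~ d), (d * e); first by rewrite mulf_neq0.
  by rewrite tpairBl (tpair_invM x d e0) (tpair_invM y e d0) [e * d]mulrC.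
- exists (x *~ numq q), (denq q); first exact: denq_neq0.
  rewrite tpairMzl -[RHS]tpairMzr; congr tpair.
  by rewrite -[RHS]mulrzl divq_num_den.
Qed.

Lemma scale_tpair (q r : rat) (x : M) :
  q *: (tpair x r : rationalization M) = tpair x (q * r).
Proof. exact: qscale_pair. Qed.

End Torsion.

Lemma common_denominator (T : finType) (q : T -> rat) :
  exists2 d : int, d != 0 & exists c : T -> int, forall t, q t * d%:~R = (c t)%:~R.
Proof.
exists (\prod_t denq (q t)); first by apply/prodf_neq0 => t _; exact: denq_neq0.
exists (fun t => numq (q t) * \prod_(u | u != t) denq (q u)) => t.
rewrite (bigD1 t) //= !intrM mulrA -{1}[q t]divq_num_den mulfVK //.
by rewrite intr_eq0 denq_neq0.
Qed.

Section QBasis.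
Variable M : zmodType.
Implicit Types S : zmodClosed M.

Definition zindep (T : finType) (v : T -> M) : Prop :=
  forall c : T -> int, \sum_t v t *~ c t = 0 -> forall t, c t = 0.

(** States inside M that y tensor 1 lies in the rational span of the [v t] tensor 1; the factor [m]
    clears the denominators and also absorbs torsion. *)
Definition qspan (T : finType) (v : T -> M) (y : M) : Prop :=
  exists2 m : int, m != 0 & exists c : T -> int, y *~ m = \sum_t v t *~ c t.

Definition qbasis S (T : finType) (v : T -> M) : Prop :=
  [/\ forall t, v t \in S, zindep v & forall y, y \in S -> qspan v y].

Definition has_rank S (n : nat) : Prop := exists v : 'I_n -> M, qbasis S v.

Lemma qbasis_rank S (T : finType) (v : T -> M) : qbasis S v -> has_rank S #|T|.
Proof.
case=> vS vI vQ; exists (v \o enum_val); split=> [k|c c0 k|y /vQ[m m0 [c yE]]].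
- exact: vS.
- have := vI (c \o enum_rank) _ (enum_val k); rewrite /= enum_valK; apply.
  rewrite -{}[RHS]c0 (reindex (enum_val : 'I_#|T| -> T)) /=; last first.
    by apply: onW_bij; exists enum_rank; [exact: enum_valK | exact: enum_rankK].
  by apply: eq_bigr => i _; rewrite enum_valK.
- exists m => //; exists (c \o enum_val); rewrite yE (reindex (enum_val : 'I_#|T| -> T)) //=.
  by apply: onW_bij; exists enum_rank; [exact: enum_valK | exact: enum_rankK].
Qed.

Local Notation MQ := (rationalization M).
Local Notation "x %:MQ" := (tpair x (1 : rat) : MQ) (at level 2).

Lemma int_scale_tpair1 (x : M) (c : int) : c%:~R *: x%:MQ = (x *~ c)%:MQ.
Proof. by rewrite scale_tpair mulr1 tpairMzl -[RHS]tpairMzr. Qed.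

(** The map [lc] from rational row vectors to M tensor Q is injective because a kernel vector, once
    its denominators are cleared, gives a torsion element and hence an integer relation among the
    [v k]. It is surjective because every tensor is a single fraction x / d. *)
Lemma qbasis_has_dim n (v : 'I_n -> M) :
  zindep v -> (forall y, qspan v y) -> has_dim MQ n.
Proof.
move=> vI vQ; pose lc (q : 'rV[rat]_n) : MQ := \sum_k q 0 k *: (v k)%:MQ.
have lc_lin : linear lc.
  move=> a p q; rewrite /lc scaler_sumr -big_split /=; apply: eq_bigr => k _.
  by rewrite !mxE scalerDl scalerA.
have lc_int (q : 'rV[rat]_n) d c : (forall k, q 0 k * d%:~R = (c k)%:~R) ->
    d%:~R *: lc q = (\sum_k v k *~ c k)%:MQ.
  move=> qE; rewrite tpair_suml scaler_sumr; apply: eq_bigr => k _.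
  by rewrite scalerA mulrC qE int_scale_tpair1.
have lc0 q : lc q = 0 -> q = 0.
  move=> q0; have [d d0 [c qE]] := common_denominator (q 0).
  have := lc_int q d c qE; rewrite q0 scaler0 => /esym/tpair1_eq0[m m0].
  rewrite mulrz_suml => e0; apply/rowP => k; rewrite mxE.
  have : c k * m = 0.
    by apply: (vI (fun k => c k * m)); rewrite -[RHS]e0; apply: eq_bigr => i _; rewrite mulrzA.
  move/eqP; rewrite mulf_eq0 (negbTE m0) orbF => /eqP ck.
  move/eqP: (qE k); rewrite ck mulf_eq0 intr_eq0 (negbTE d0) orbF.
  by move/eqP.
have lcI : injective lc.
  move=> p q pq; apply/eqP; rewrite -subr_eq0; apply/eqP/lc0.
  by rewrite -[p - q]addrC -scaleN1r lc_lin pq scaleN1r addNr.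
have lcS w : exists q, lc q = w.
  have [x [d d0 ->]] := rationalizationP w; have [m m0 [c xE]] := vQ x.
  have u0 : (m * d)%:~R != 0 :> rat by rewrite intr_eq0 mulf_neq0.
  exists (\row_k ((c k)%:~R / (m * d)%:~R)).
  apply: (scalerI u0); rewrite (lc_int _ _ c) => [|k]; last by rewrite mxE mulfVK.
  rewrite -xE intrM scale_tpair mulfK ?intr_eq0 //.
  by rewrite -int_scale_tpair1 scale_tpair mulr1.
have [g gK] := choice lcS; split; exists g.
  by move=> a x y; apply: lcI; rewrite lc_lin !gK.
by exists lc => // q; apply: lcI; rewrite gK.
Qed.

(** Each vector of a basis of M tensor Q is a fraction [x k] / [d k]; the numerators form the
    required family, since they differ from the basis by nonzero scalars. *)
Lemma has_dim_qbasis n : has_dim MQ n ->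
  exists v : 'I_n -> M, zindep v /\ forall y, qspan v y.
Proof.
case=> -[r r_lin [g rK gK]].
pose rL : {linear MQ -> 'rV[rat]_n} := HB.pack r (GRing.isLinear.Build _ _ _ _ r r_lin).
have rZ a w : r (a *: w) = a *: r w by exact: (linearZ_LR rL).
have rS (F : 'I_n -> MQ) : r (\sum_k F k) = \sum_k r (F k) by exact: (linear_sum rL).
have rB w w' : r (w - w') = r w - r w' by exact: (linearB rL).
have r0 : r 0 = 0 by exact: (linear0 rL).
have [x xP] := choice (fun k => rationalizationP (g (delta_mx 0 k))).
have {xP} xP k : exists d, d != 0 /\ g (delta_mx 0 k) = tpair (x k) (d%:~R^-1 : rat).
  by have [d] := xP k; exists d.
have [d dP] := choice xP.
have d0 k : (d k)%:~R != 0 :> rat by rewrite intr_eq0; case: (dP k).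
have rx k : r (x k)%:MQ = (d k)%:~R *: delta_mx 0 k.
  rewrite -[delta_mx 0 k in RHS]gK -rZ; case: (dP k) => _ ->.
  by rewrite scale_tpair divff.
have rc c j : r (\sum_k x k *~ c k)%:MQ 0 j = (c j * d j)%:~R.
  rewrite tpair_suml rS summxE (bigD1 j) //= big1 ?addr0 => [|i ij].
    by rewrite -int_scale_tpair1 rZ rx !mxE !eqxx mulr1 intrM.
  by rewrite -int_scale_tpair1 rZ rx !mxE [j == i]eq_sym (negbTE ij) andbF !mulr0.
exists x; split=> [c c0 k|y].
  have := rc c k; rewrite c0 tpair0l r0 mxE intrM => /esym/eqP.
  by rewrite mulf_eq0 (negbTE (d0 k)) orbF intr_eq0 => /eqP.
have [D D0 [c cE]] := common_denominator (fun k => r y%:MQ 0 k / (d k)%:~R).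
have : (y *~ D - \sum_k x k *~ c k)%:MQ = 0.
  apply: (can_inj rK); rewrite tpairBl rB r0; apply/rowP => k.
  rewrite mxE [X in _ + X]mxE rc -int_scale_tpair1 rZ !mxE intrM -cE mulrAC.
  by rewrite mulfVK // mulrC subrr.
case/tpair1_eq0 => m m0 /eqP; rewrite mulrzBl subr_eq0 -mulrzA => /eqP yE.
exists (D * m); first by rewrite mulf_neq0.
exists (fun k => c k * m); rewrite yE mulrz_suml; apply: eq_bigr => k _.
by rewrite mulrzA.
Qed.

End QBasis.

(** The change of coordinates between the two models is an injective linear map of row spaces, so
    its matrix has full row rank, at most the number of its columns. *)
Lemma has_dim_uniq (K : fieldType) (V : lmodType K) m n :
  has_dim V m -> has_dim V n -> m = n.
Proof.
have le p q : has_dim V p -> has_dim V q -> (p <= q)%N.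
  case=> -[r r_lin [g rK gK]] [[r' r'_lin [g' r'K g'K]]].
  have g_lin : linear g by move=> a x y; apply: (can_inj rK); rewrite r_lin !gK.
  have h_lin : linear (r' \o g) by move=> a x y /=; rewrite g_lin r'_lin.
  pose h : {linear 'rV[K]_p -> 'rV[K]_q} :=
    HB.pack (r' \o g) (GRing.isLinear.Build _ _ _ _ _ h_lin).
  have hI : injective h by move=> x y /= /(can_inj r'K) /(can_inj gK).
  have : row_free (lin1_mx h).
    apply: inj_row_free => u; rewrite mul_rV_lin1 -(linear0 h).
    exact: hI.
  by rewrite /row_free => /eqP <-; exact: rank_leq_col.
by move=> Vm Vn; apply/eqP; rewrite eqn_leq !le.
Qed.

Lemma dimE (K : fieldType) (V : lmodType K) n : has_dim V n -> Defs.dim V = n.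
Proof.
move=> Vn; rewrite /Defs.dim; case: pselect => [h|[]]; last by exists n.
by case: cid => m Vm /=; exact: has_dim_uniq Vm Vn.
Qed.

Section Rank.
Variables (M : zmodType) (S : zmodClosed M).

Lemma has_rankE n : has_rank S n <-> has_dim (rationalization (subm S)) n.
Proof.
have vS (T : finType) (v : T -> subm S) (c : T -> int) :
    val (\sum_t v t *~ c t) = \sum_t val (v t) *~ c t.
  by rewrite raddf_sum; apply: eq_bigr => t _; rewrite raddfMz.
split=> [[v [vS' vI vQ]]|/has_dim_qbasis[v [vI vQ]]].
  apply: (@qbasis_has_dim _ _ (fun k => Sub (v k) (vS' k) : subm S)) => [c c0|y].
    by apply: vI; have := congr1 val c0; rewrite vS.
  have [m m0 [c yE]] := vQ _ (valP y); exists m => //; exists c.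
  by apply: val_inj; rewrite vS raddfMz.
exists (val \o v); split=> [k|c c0|y Sy].
- exact: valP.
- by apply: vI; apply: val_inj; rewrite vS.
have [m m0 [c yE]] := vQ (Sub y Sy); exists m => //; exists c.
by have := congr1 val yE; rewrite vS raddfMz.
Qed.

Lemma has_rank_uniq m n : has_rank S m -> has_rank S n -> m = n.
Proof. by move=> /has_rankE Sm /has_rankE; exact: has_dim_uniq. Qed.

End Rank.

(** * Existence of ranks and additivity along homomorphisms *)

Section RankNullity.

(** With more vectors than the rank, the rational matrix of their coordinates has a nonzero left
    kernel vector. Clearing its denominators gives an integer relation among the [w i *~ m i], which
    contradicts independence. *)
Lemma zindep_leq (M : zmodType) (S : zmodClosed M) n k (w : 'I_k -> M) :
  has_rank S n -> (forall i, w i \in S) -> zindep w -> (k <= n)%N.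
Proof.
case=> v [_ _ vQ] wS wI; rewrite leqNgt; apply/negP => ltnk.
have /choice[m mP] i : exists m : int, m != 0 /\
    exists c : 'I_n -> int, w i *~ m = \sum_l v l *~ c l.
  by have [m m0 cE] := vQ _ (wS i); exists m.
have /choice[c cP] i : exists c : 'I_n -> int, w i *~ m i = \sum_l v l *~ c l.
  by case: (mP i).
pose C : 'M[rat]_(k, n) := \matrix_(i, l) (c i l)%:~R.
have /rowV0Pn[u /sub_kermxP uC u0] : kermx C != 0.
  rewrite kermx_eq0 /row_free neq_ltn; apply/orP; left.
  exact: leq_ltn_trans (rank_leq_col _) ltnk.
have [d d0 [a aE]] := common_denominator (u 0).
have ac l : \sum_i c i l * a i = 0.
  apply/eqP; rewrite -(intr_eq0 rat) raddf_sum /=.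
  have /matrixP/(_ 0 l)/(congr1 (fun x => x * d%:~R)) := uC.
  rewrite !mxE mul0r mulr_suml => uE.
  rewrite -[X in _ == X]uE; apply/eqP/eq_bigr => i _.
  by rewrite mxE intrM -aE mulrCA mulrA.
have a0 i : a i = 0.
  suff /eqP : m i * a i = 0.
    by rewrite mulf_eq0; case: (mP i) => /negbTE -> _ /eqP.
  apply: (wI (fun i => m i * a i)).
  rewrite (eq_bigr (fun i => \sum_l v l *~ (c i l * a i))) => [|j _].
    rewrite exchange_big big1 //= => l _.
    by rewrite -mulrz_sumr ac mulr0z.
  by rewrite mulrzA cP mulrz_suml; apply: eq_bigr => l _; rewrite mulrzA.
case/eqP: u0; apply/rowP => i; rewrite mxE.
have /eqP := aE i; rewrite a0 mulf_eq0 intr_eq0 (negbTE d0) orbF.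
by move/eqP.
Qed.

(** An independent family of maximal size is a rational basis: an element outside its rational span
    could be added to it. *)
Lemma has_rank_bounded (M : zmodType) (S : zmodClosed M) n :
  (forall k (w : 'I_k -> M), (forall i, w i \in S) -> zindep w -> (k <= n)%N) ->
  exists k, has_rank S k.
Proof.
move=> bnd; pose P k := `[< exists w : 'I_k -> M, (forall i, w i \in S) /\ zindep w >].
have P0 : exists k, P k.
  by exists 0%N; apply/asboolP; exists (fun=> 0); split=> [[]|c _ []].
have Pn k : P k -> (k <= n)%N by move=> /asboolP[w [wS wI]]; exact: bnd wS wI.
case: (ex_maxnP P0 Pn) => k /asboolP[w [wS wI]] kmax; exists k, w; split=> // y Sy.
apply: contrapT => ny; have : P k.+1.
  apply/asboolP; exists (fun i => oapp w y (unlift ord0 i)); split=> [i|c].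
    by case: unlift.
  rewrite big_ord_recl unlift_none /= (eq_bigr (fun i => w i *~ c (fintype.lift ord0 i))).
    (* A nonzero coefficient of [y] would serve as the denominator that puts [y] in the rational
       span of [w]. *)
    move=> c0; have c00 : c ord0 = 0.
      apply/eqP; apply: contrapT => /negP cn0; apply: ny; exists (c ord0) => //.
      exists (fun i => - c (fintype.lift ord0 i)).
      under eq_bigr do rewrite mulrNz.
      by rewrite sumrN; apply/eqP; rewrite -addr_eq0 c0.
    move: c0; rewrite c00 mulr0z add0r => cl0 i.
    by case: (unliftP ord0 i) => [j|] ->; first exact: (wI (c \o fintype.lift ord0)).
  by move=> i _; rewrite liftK.
by move/kmax; rewrite ltnn.
Qed.

(** A basis of the kernel together with lifts of a basis of the image is a basis of S. Kernel and
    image are described by membership, which lets the result apply both to the differential and to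
    the passage from cocycles to classes. *)
Lemma rank_nullity (M N : zmodType) (f : {additive M -> N})
  (S K : zmodClosed M) (T : zmodClosed N) n :
  has_rank S n -> (forall x, x \in K <-> x \in S /\ f x = 0) ->
  (forall y, y \in T <-> exists2 x, x \in S & y = f x) ->
  exists a b, [/\ has_rank K a, has_rank T b & n = (a + b)%N].
Proof.
move=> Sn KE TE.
have [a Ka] : exists a, has_rank K a.
  by apply: (@has_rank_bounded _ _ n) => k w wK; apply: zindep_leq Sn _ => i; case/KE: (wK i).
have fsum k (w : 'I_k -> M) c : f (\sum_i w i *~ c i) = \sum_i f (w i) *~ c i.
  by rewrite raddf_sum; apply: eq_bigr => i _; rewrite raddfMz.
have lift_T k (w : 'I_k -> N) : (forall i, w i \in T) ->
    exists u : 'I_k -> M, forall i, u i \in S /\ w i = f (u i).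
  move=> wT.
  have /choice[u uP] i : exists x, x \in S /\ w i = f x by have /TE[x Sx wE] := wT i; exists x.
  by exists u.
have [b Tb] : exists b, has_rank T b.
  apply: (@has_rank_bounded _ _ n) => k w /lift_T[u uP] wI.
  apply: (@zindep_leq _ _ _ _ u Sn) => [i|c c0]; first by case: (uP i).
  apply: wI; apply: etrans (raddf0 f); rewrite -c0 fsum.
  by apply: eq_bigr => i _; case: (uP i) => _ ->.
exists a, b; split=> //; case: Ka => u [uK uI uQ]; case: Tb => w' [/lift_T[w wP] wI wQ].
pose v (t : 'I_a + 'I_b) := match t with inl i => u i | inr j => w j end.
have Sab : has_rank S (a + b).
  rewrite -[a]card_ord -[b in (_ + b)%N]card_ord -card_sum.
  apply: (@qbasis_rank _ _ _ v); split=> [[i|j]|c|y Sy].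
  - by case/KE: (uK i).
  - by case: (wP j).
  - rewrite big_sumType /= => c0.
    have c2 j : c (inr j) = 0.
      apply: (wI (fun j => c (inr j))); have := congr1 f c0.
      rewrite raddfD !fsum raddf0 big1 ?add0r => [c20|i _].
        by rewrite -[RHS]c20; apply: eq_bigr => i _; case: (wP i) => _ ->.
      by case/KE: (uK i) => _ ->; rewrite mul0rz.
    case=> // i; apply: (uI (fun i => c (inl i))); move: c0.
    by rewrite [X in _ + X]big1 ?addr0 // => j _; rewrite c2 mulr0z.
  have [m m0 [c fyE]] : qspan w' (f y) by apply: wQ; apply/TE; exists y.
  (* After the lifts with the coefficients of [f y] are subtracted, the multiple of [y] is in the
     kernel, where the family [u] takes over. *)
  have : y *~ m - \sum_j w j *~ c j \in K.
    apply/KE; split.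
      rewrite rpredB ?rpredMz // rpred_sum // => j _; rewrite rpredMz //.
      by case: (wP j).
    rewrite raddfB fsum raddfMz fyE; apply/eqP; rewrite subr_eq0; apply/eqP.
    by apply: eq_bigr => j _; case: (wP j) => _ ->.
  case/uQ => m' m'0 [c' /eqP]; rewrite mulrzBl subr_eq => /eqP yE.
  exists (m * m'); first by rewrite mulf_neq0.
  exists (fun t => match t with inl i => c' i | inr j => c j * m' end).
  rewrite big_sumType /= mulrzA yE mulrz_suml; congr (_ + _).
  by apply: eq_bigr => j _; rewrite mulrzA.
exact: has_rank_uniq Sn Sab.
Qed.

Lemma has_rank_bij (M N : zmodType) (f : {additive M -> N})
  (S : zmodClosed M) (T : zmodClosed N) n :
  bijective f -> (forall x, (f x \in T) = (x \in S)) -> has_rank S n -> has_rank T n.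
Proof.
case=> g fK gK fT [v [vS vI vQ]].
have fsum c : f (\sum_i v i *~ c i) = \sum_i f (v i) *~ c i.
  by rewrite raddf_sum; apply: eq_bigr => i _; rewrite raddfMz.
exists (f \o v); split=> [k|c c0|y Ty].
- by rewrite fT.
- by apply: vI; apply: (can_inj fK); rewrite fsum raddf0.
have [|m m0 [c yE]] := vQ (g y); first by rewrite -fT gK.
by exists m => //; exists c; rewrite -fsum -yE raddfMz gK.
Qed.

End RankNullity.

(** * Bigraded groups and their q-dimension *)

Section Gradings.
Variable M : zmodType.

Lemma span_ind (R P : M -> Prop) :
  P 0 -> (forall x y, P x -> P y -> P (x - y)) -> (forall x, R x -> P x) ->
  forall x, x \in Defs.span R -> P x.
Proof.
move=> P0 PB PR x; pose P' : {pred M} := [pred y | `[< P y >]].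
have P'c : zmod_closed P'.
  split=> [|y z]; rewrite !inE; first exact/asboolP.
  by move=> /asboolP Py /asboolP Pz; apply/asboolP/PB.
pose Q : zmodClosed M := HB.pack_for (zmodClosed M) P' (GRing.isZmodClosed.Build M P' P'c).
rewrite inE => /asboolP/(_ Q) Qx; apply/asboolP.
by apply: Qx => y Ry; rewrite inE; apply/asboolP/PR.
Qed.

Lemma span_sub (R : M -> Prop) (S : zmodClosed M) x :
  (forall y, R y -> y \in S) -> x \in Defs.span R -> x \in S.
Proof.
by move=> RS; apply: (@span_ind _ (fun x => x \in S)) => // [|y z]; [exact: rpred0 | exact: rpredB].
Qed.

Variable g : bigrading M.

Definition homog (x : M) : Prop := exists i j, x \in g i j.

(** Unlike decompositions of single elements, additive projections can be tensored and summed, so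
    gradings of constructed modules are obtained from them. *)
Definition graded_proj (p : nat -> nat -> {additive M -> M}) : Prop :=
  [/\ forall i j x, p i j x \in g i j,
      forall i j x, x \in g i j -> p i j x = x
    & forall i j k l x, x \in g k l -> (k == i) && (l == j) = false -> p i j x = 0].

Lemma sum_square_pad (a : nat -> nat -> M) N K : (N <= K)%N ->
  (forall i j, (i < N)%N && (j < N)%N = false -> a i j = 0) ->
  \sum_(i < K) \sum_(j < K) a i j = \sum_(i < N) \sum_(j < N) a i j.
Proof.
move=> leNK a0; rewrite [RHS](big_ord_widen K (fun i => \sum_(j < N) a i j)) //.
rewrite [RHS]big_mkcond /=; apply: eq_bigr => i _; case: ltnP => iN; last first.
  by rewrite big1 // => j _; rewrite a0 // ltnNge iN.
rewrite [RHS](big_ord_widen K (a i)) // [RHS]big_mkcond /=; apply: eq_bigr => j _.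
by case: ltnP => // jN; rewrite a0 // andbC ltnNge jN.
Qed.

Lemma sum_square_delta (a : nat -> nat -> M) N i j : (i < N)%N -> (j < N)%N ->
  \sum_(k < N) \sum_(l < N) (if (k == i :> nat) && (l == j :> nat) then a k l else 0) = a i j.
Proof.
move=> iN jN; rewrite (bigD1 (Ordinal iN)) //= [X in _ + X]big1 => [|k ki].
  rewrite addr0 (bigD1 (Ordinal jN)) //= !eqxx big1 ?addr0 //= => l lj.
  by rewrite ifF //; apply/negbTE: lj.
by rewrite big1 // => l _; rewrite ifF //; apply/negbTE; rewrite negb_and; apply/orP; left.
Qed.

(** Decompositions exist because decomposable elements form a subgroup containing the homogeneous
    ones; they are unique because [p i j] extracts the component of bidegree (i, j) from any of
    them. *)
Lemma is_bigraded_intro (p : nat -> nat -> {additive M -> M}) :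
  graded_proj p -> (forall x, x \in Defs.span homog) -> is_bigraded g.
Proof.
case=> pg pid p0 gen; split=> [x|N h hg h0 i j iN jN].
  move: (gen x); move: x; apply: span_ind => [|x1 x2|y [i [j yg]]].
  - by exists 0%N, (fun _ _ => 0); split=> [i j|]; rewrite ?rpred0 ?big_ord0.
  - move=> [N1 [h1 [hg1 ->]]] [N2 [h2 [hg2 ->]]]; exists (maxn N1 N2).
    (* The two squares may differ in size and the families are arbitrary outside them, so both are
       cut to zero before being subtracted. *)
    pose cut N (h : nat -> nat -> M) i j := if (i < N)%N && (j < N)%N then h i j else 0.
    have cutg N h : (forall i j, h i j \in g i j) -> forall i j, cut N h i j \in g i j.
      by move=> hg i j; rewrite /cut; case: ifP; rewrite ?rpred0.
    have cutE N (h : nat -> nat -> M) K : (N <= K)%N -> \sum_(i < N) \sum_(j < N) h i j =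
        \sum_(i < K) \sum_(j < K) cut N h i j.
      move=> leNK; rewrite [RHS](@sum_square_pad _ N) // => [|i j]; last by rewrite /cut => ->.
      by apply: eq_bigr => i _; apply: eq_bigr => j _; rewrite /cut !ltn_ord.
    exists (fun i j => cut N1 h1 i j - cut N2 h2 i j).
    split=> [i j|]; first by rewrite rpredB ?cutg.
    rewrite (cutE N1 h1 (maxn N1 N2)) ?leq_maxl // (cutE N2 h2 (maxn N1 N2)) ?leq_maxr //.
    by rewrite -sumrB; apply: eq_bigr => i _; rewrite -sumrB.
  - exists (maxn i j).+1, (fun k l => if (k == i) && (l == j) then y else 0).
    split=> [k l|]; first by case: ifP => [/andP[/eqP -> /eqP ->]|]; rewrite ?rpred0.
    by rewrite (sum_square_delta (fun _ _ => y)) // ltnS ?leq_maxl ?leq_maxr.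
have := congr1 (p i j) h0; rewrite raddf0 raddf_sum.
rewrite (eq_bigr (fun k : 'I_N => \sum_(l < N)
  (if (k == i :> nat) && (l == j :> nat) then h k l else 0))).
  by rewrite sum_square_delta.
move=> k _; rewrite raddf_sum; apply: eq_bigr => l _.
case: ifP => [/andP[/eqP ki /eqP lj]|nkl]; last exact: (p0 _ _ _ _ _ (hg k l) nkl).
by rewrite pid // -ki -lj.
Qed.

(** A decomposition is chosen for every x. The choice itself need not be additive, but components
    are unique, so the difference of the decompositions of x and y computes the components of x -
    y. *)
Lemma is_bigraded_proj : is_bigraded g -> exists p, graded_proj p.
Proof.
case=> gsum guniq; have /choice[N /choice[h hP]] := gsum.
pose p i j x := if (i < N x)%N && (j < N x)%N then h x i j else 0.
have pg i j x : p i j x \in g i j.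
  by rewrite /p; case: ifP; rewrite ?rpred0 //; case: (hP x).
have p0 i j x : (i < N x)%N && (j < N x)%N = false -> p i j x = 0 by rewrite /p => ->.
have psum K x : (N x <= K)%N -> \sum_(i < K) \sum_(j < K) p i j x = x.
  move=> leNK; rewrite (@sum_square_pad (fun i j => p i j x) (N x)) => [|//|i j]; last exact: p0.
  rewrite [RHS](proj2 (hP x)); apply: eq_bigr => i _; apply: eq_bigr => j _.
  by rewrite /p !ltn_ord.
(* Any homogeneous family supported in some square and summing to [x] has the components [p i j x],
   whatever the size of that square. *)
have puniq x a K : (forall i j, a i j \in g i j) ->
    (forall i j, (i < K)%N && (j < K)%N = false -> a i j = 0) ->
    x = \sum_(i < K) \sum_(j < K) a i j -> forall i j, p i j x = a i j.
  move=> ag a0 xE i j; set L := maxn K (N x).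
  have [|] := boolP ((i < L)%N && (j < L)%N).
    case/andP=> iL jL; apply/eqP; rewrite -subr_eq0; apply/eqP.
    apply: (guniq L (fun i j => p i j x - a i j)) => // [k l|]; first by rewrite rpredB.
    under eq_bigr do rewrite sumrB.
    rewrite sumrB psum ?leq_maxr // (@sum_square_pad a K) ?leq_maxl // -xE.
    exact: subrr.
  move=> /negbTE nL; rewrite p0 ?a0 //; apply: contraFF nL => /andP[iN jN];
    by rewrite /L !leq_max iN jN ?orbT.
have pB i j : zmod_morphism (p i j).
  move=> x y; apply: (puniq _ (fun i j => p i j x - p i j y) (maxn (N x) (N y))).
  - by move=> k l; rewrite rpredB.
  - move=> k l nL; rewrite !p0 ?subrr //; apply: contraFF nL => /andP[kN lN];
      by rewrite !leq_max kN lN ?orbT.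
  - under eq_bigr do rewrite sumrB.
    by rewrite sumrB !psum ?leq_maxl ?leq_maxr.
have pE i j x : x \in g i j -> forall k l, p k l x = if (k == i) && (l == j) then x else 0.
  move=> xg; apply: (puniq _ _ (maxn i j).+1).
  - by move=> k l; case: ifP => [/andP[/eqP -> /eqP ->]|]; rewrite ?rpred0.
  - move=> k l nL; case: ifP => // /andP[/eqP ki /eqP lj].
    by move: nL; rewrite ki lj !ltnS leq_maxl leq_maxr.
  - by rewrite (sum_square_delta (fun _ _ => x)) // ltnS ?leq_maxl ?leq_maxr.
exists (fun i j => zadd (pB i j)); split=> [//|i j x xg|i j k l x xg nkl] /=.
  by rewrite (pE _ _ _ xg) !eqxx.
by rewrite (pE _ _ _ xg) [i == k]eq_sym [j == l]eq_sym nkl.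
Qed.

Lemma is_bigraded_gen : is_bigraded g -> forall x, x \in Defs.span homog.
Proof.
case=> gsum _ x; have [N [h [hg ->]]] := gsum x.
apply: rpred_sum => i _; apply: rpred_sum => j _; apply: span_gen.
by exists i, j.
Qed.

End Gradings.

(** The union of bases of the summands is a basis of S: applying [p k] to a relation isolates the
    relation inside [T k], and rational combinations of the components add up over a common
    denominator. *)
Lemma rank_direct_sum (M : zmodType) (K : finType) (S : zmodClosed M)
  (T : K -> zmodClosed M) (r : K -> nat) (p : K -> {additive M -> M}) :
  (forall k, has_rank (T k) (r k)) ->
  (forall k x, x \in T k -> x \in S) ->
  (forall k x, x \in T k -> p k x = x) ->
  (forall k l x, x \in T k -> k != l -> p l x = 0) ->
  (forall x, x \in S -> x = \sum_k p k x /\ forall k, p k x \in T k) ->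
  has_rank S (\sum_k r k)%N.
Proof.
move=> Tr TS pid p0 Ssum.
have [v vP] : exists v : forall k, 'I_(r k) -> M, forall k, qbasis (T k) (v k).
  by exists (fun k => projT1 (cid (Tr k))) => k; case: cid.
pose w (t : {k : K & 'I_(r k)}) := v (tag t) (tagged t).
have <- : #|{: {k : K & 'I_(r k)}}| = (\sum_k r k)%N.
  rewrite card_tagged sumnE big_map big_enum /=.
  by apply: eq_bigr => k _; rewrite card_ord.
have sumT (F : forall k, 'I_(r k) -> M) :
    \sum_(t : {k : K & 'I_(r k)}) F (tag t) (tagged t) = \sum_k \sum_(i < r k) F k i.
  by rewrite sig_big_dep.
apply: (@qbasis_rank _ _ _ w); split=> [[k i]|c|x Sx].
- by have [vS _ _] := vP k; apply: (TS k); exact: vS.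
- move=> c0 [k i]; have [_ vI _] := vP k.
  apply: (vI (fun i => c (Tagged (fun k => 'I_(r k)) i))).
  apply: etrans (raddf0 (p k)); rewrite -[in RHS]c0 {c0}.
  rewrite (eq_bigr (fun t => v (tag t) (tagged t) *~ c (Tagged (fun k => 'I_(r k)) (tagged t)))).
    rewrite (sumT (fun k i => v k i *~ c (Tagged (fun k => 'I_(r k)) i))).
    rewrite raddf_sum (bigD1 k) //= [X in _ + X]big1 ?addr0 => [|l lk].
      rewrite raddf_sum; apply: eq_bigr => j _; rewrite raddfMz pid //.
      by have [vS _ _] := vP k; exact: vS.
    rewrite raddf_sum big1 // => j _; rewrite raddfMz (p0 l) ?mul0rz //.
    by have [vS _ _] := vP l; exact: vS.
  by case.
- have [xE xT] := Ssum x Sx.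
  have /choice[m mP] k : exists m : int, m != 0 /\
      exists c : 'I_(r k) -> int, p k x *~ m = \sum_i v k i *~ c i.
    by have [_ _ vQ] := vP k; have [m m0 cE] := vQ _ (xT k); exists m.
  have [c cP] : exists c : forall k, 'I_(r k) -> int,
      forall k, p k x *~ m k = \sum_i v k i *~ c k i.
    by exists (fun k => projT1 (cid (proj2 (mP k)))) => k; case: cid.
  (* The product of all the denominators serves every summand; the coefficients from summand k are
     multiplied by the other factors. *)
  exists (\prod_k m k); first by apply/prodf_neq0 => k _; case: (mP k).
  exists (fun t => c (tag t) (tagged t) * \prod_(l | l != tag t) m l).
  rewrite (sumT (fun k i => v k i *~ (c k i * \prod_(l | l != k) m l))).
  rewrite {1}xE mulrz_suml; apply: eq_bigr => k _.
  rewrite (bigD1 k) //= mulrzA cP mulrz_suml; apply: eq_bigr => i _.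
  by rewrite mulrzA.
Qed.

(** The coordinate is c / m for any expression of a multiple by m; independence of [v] makes the
    fraction the same for all expressions. Additivity is available only on S, since elsewhere the
    value is a default. *)
Lemma coordinates (M : zmodType) (S : zmodClosed M) n (v : 'I_n -> M) :
  qbasis S v -> exists phi : 'I_n -> M -> rat,
    (forall k x y, x \in S -> y \in S -> phi k (x - y) = phi k x - phi k y) /\
    (forall k l, phi k (v l) = (k == l)%:R).
Proof.
case=> vS vI vQ.
have /choice[mc mcP] x : exists mc : int * ('I_n -> int),
    x \in S -> mc.1 != 0 /\ x *~ mc.1 = \sum_k v k *~ mc.2 k.
  have [/vQ[m m0 [c cE]]|nS] := boolP (x \in S); first by exists (m, c).
  by exists (0, fun=> 0).
have uniq x m c : x \in S -> m != 0 -> x *~ m = \sum_k v k *~ c k ->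
    forall k, ((mc x).2 k)%:~R / ((mc x).1)%:~R = (c k)%:~R / m%:~R :> rat.
  move=> Sx m0 xE k; have [n0 xE'] := mcP x Sx; apply/eqP.
  rewrite eqr_div ?intr_eq0 // -!intrM eqr_int -subr_eq0; apply/eqP.
  apply: (vI (fun k => (mc x).2 k * m - c k * (mc x).1)).
  under eq_bigr do rewrite mulrzBr.
  rewrite sumrB; apply/eqP; rewrite subr_eq0; apply/eqP.
  transitivity (x *~ ((mc x).1 * m)).
    by rewrite mulrzA xE' mulrz_suml; apply: eq_bigr => i _; rewrite mulrzA.
  by rewrite mulrC mulrzA xE mulrz_suml; apply: eq_bigr => i _; rewrite mulrzA.
exists (fun k x => ((mc x).2 k)%:~R / ((mc x).1)%:~R); split=> [k x y Sx Sy|k l].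
  have [[m0 xE] [n0 yE]] := (mcP x Sx, mcP y Sy).
  rewrite (uniq _ ((mc x).1 * (mc y).1)
    (fun k => (mc x).2 k * (mc y).1 - (mc y).2 k * (mc x).1)) ?rpredB ?mulf_neq0 //.
    by rewrite -[in RHS]mulNr addf_div ?intr_eq0 // intrB !intrM mulNr.
  under eq_bigr do rewrite mulrzBr.
  rewrite sumrB mulrzBl mulrzA xE mulrC mulrzA yE !mulrz_suml.
  by congr (_ - _); apply: eq_bigr => i _; rewrite mulrzA.
rewrite (uniq _ 1 (fun k => (k == l)%:R)) //.
  by rewrite invr1 mulr1; case: (k == l).
rewrite mulr1z (bigD1 l) //= eqxx mulr1z big1 ?addr0 // => i /negbTE ->.
by rewrite mulr0z.
Qed.

(** * Ranks and gradings of tensor products *)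

Section TensorRank.
Variables (M N : zmodType) (S : zmodClosed M) (S' : zmodClosed N).

Definition tens_span : {pred tens M N} :=
  Defs.span (fun t => exists x y, [/\ x \in S, y \in S' & t = tpair x y]).

HB.instance Definition _ := GRing.ZmodClosed.on tens_span.

Variables (p : {additive M -> M}) (p' : {additive N -> N}).
Hypotheses (pS : forall x, p x \in S) (pid : forall x, x \in S -> p x = x).
Hypotheses (pS' : forall x, p' x \in S') (pid' : forall x, x \in S' -> p' x = x).

(** Composed with the projections, the coordinates become additive on all of M and N. Their products
    are then functionals on the whole tensor product, dual to the tensors of basis vectors, and this
    gives independence. *)
Lemma tens_span_rank m n :
  has_rank S m -> has_rank S' n -> has_rank tens_span (m * n).
Proof.
case=> v vP [v' vP']; have [phi [phiB phiv]] := coordinates vP.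
have [phi' [phiB' phiv']] := coordinates vP'.
have [[vS vI vQ] [vS' vI' vQ']] := (vP, vP').
have DB k : zmod_morphism (phi k \o p) by move=> x y /=; rewrite raddfB phiB.
have DB' k : zmod_morphism (phi' k \o p') by move=> x y /=; rewrite raddfB phiB'.
pose h k x y := zadd (DB k.1) x * zadd (DB' k.2) y.
have hh k : biadditive (h k).
  by split=> x y z; rewrite /h raddfD ?mulrDl ?mulrDr.
pose D k := zadd (tens_lift_additive (hh k)).
pose w (t : 'I_m * 'I_n) := tpair (v t.1) (v' t.2).
have Dw k t : D k (w t) = (k == t)%:R.
  rewrite /= tens_lift_pair // /h /= !pid ?pid' // phiv phiv' -natrM mulnb.
  by case: k t => [k1 k2] [t1 t2].
rewrite -[m in (m * _)%N]card_ord -[n in (_ * n)%N]card_ord -card_prod.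
apply: (@qbasis_rank _ _ _ w); split=> [t|c c0 t|].
- by apply: span_gen; exists (v t.1), (v' t.2).
- have := congr1 (D t) c0; rewrite raddf0 raddf_sum (bigD1 t) //.
  rewrite big1 => [|u ut].
    move/(etrans (esym (addr0 (D t (w t *~ c t))))); rewrite raddfMz Dw eqxx => ct0.
    by apply/eqP; rewrite -(intr_eq0 rat); apply/eqP.
  by rewrite raddfMz Dw eq_sym (negbTE ut) mul0rz.
apply: span_ind => [|x y|_ [x [y [/vQ[a a0 [c xE]] /vQ'[b b0 [d yE]] ->]]]].
- by exists 1 => //; exists (fun=> 0); rewrite mulr1z big1.
- move=> [a a0 [c xE]] [b b0 [d yE]]; exists (a * b); first by rewrite mulf_neq0.
  exists (fun t => c t * b - d t * a).
  under eq_bigr do rewrite mulrzBr.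
  rewrite sumrB mulrzBl mulrzA xE mulrC mulrzA yE !mulrz_suml.
  by congr (_ - _); apply: eq_bigr => i _; rewrite mulrzA.
- exists (a * b); first by rewrite mulf_neq0.
  exists (fun t => c t.1 * d t.2).
  rewrite mulrzA -tpairMzl -tpairMzr xE yE tpair_suml.
  rewrite -(pair_bigA _ (fun k l => tpair (v k) (v' l) *~ (c k * d l))) /=.
  apply: eq_bigr => k _; rewrite tpair_sumr; apply: eq_bigr => l _.
  by rewrite tpairMzl tpairMzr -mulrzA mulrC.
Qed.

End TensorRank.

(* M is bigraded and the coefficients of Q are the ranks of its pieces; unlike
   an equation on qdim this says that these ranks are finite. *)
Definition has_qdim (M : zmodType) (g : bigrading M) (Q : fps (fps int)) : Prop :=
  is_bigraded g /\
  forall i j, exists2 r : nat, has_rank (g i j) r & fcoef (fcoef Q i) j = r%:Z.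

Lemma has_qdimE (M : zmodType) (g : bigrading M) Q :
  has_qdim g Q -> qfinite g /\ qdim g = Q.
Proof.
case=> _ gQ; split=> [i j|]; first by have [r /has_rankE gr _] := gQ i j; exists r.
apply: fpsP => i; apply: fpsP => j /=; have [r /has_rankE gr ->] := gQ i j.
by rewrite (dimE gr).
Qed.

Lemma qfinite_has_qdim (M : zmodType) (g : bigrading M) :
  is_bigraded g -> qfinite g -> has_qdim g (qdim g).
Proof.
move=> gb gf; split=> // i j; have [r gr] := gf i j.
by exists r; [exact/has_rankE | rewrite /= (dimE gr)].
Qed.

Lemma fcoef_sum (R : comNzRingType) I r (P : pred I) (F : I -> fps R) n :
  fcoef (\sum_(i <- r | P i) F i) n = \sum_(i <- r | P i) fcoef (F i) n.
Proof. by elim/big_rec2: _ => // i x y _ <-. Qed.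

Section TensorGrading.
Variables (M N : zmodType) (g : bigrading M) (g' : bigrading N).

(** The part of bidegree (i, j) whose left factor has bidegree [k]. The truncated subtractions are
    exact because [k] ranges over ['I_i.+1 * 'I_j.+1] wherever the pieces are summed. *)
Let piece i j k := tens_span (g k.1 k.2) (g' (i - k.1)%N (j - k.2)%N).

Lemma tens_gr_pair i1 j1 i2 j2 x y : x \in g i1 j1 -> y \in g' i2 j2 ->
  tpair x y \in tens_gr g g' (i1 + i2) (j1 + j2).
Proof. by move=> xg yg; apply: span_gen; exists i1, j1, i2, j2, x, y. Qed.

Lemma tens_gr_gen : (forall x, x \in Defs.span (homog g)) ->
  (forall y, y \in Defs.span (homog g')) ->
  forall t, t \in Defs.span (homog (tens_gr g g')).
Proof.
move=> gen gen'; apply: tens_ind => [|s t hs ht|x y]; rewrite ?rpred0 ?rpredB //.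
move: (gen x); move: x; apply: span_ind => [|x1 x2 h1 h2|x [i1 [j1 xg]]].
- by rewrite tpair0l rpred0.
- by rewrite tpairBl rpredB.
move: (gen' y); move: y; apply: span_ind => [|y1 y2 h1 h2|y [i2 [j2 yg]]].
- by rewrite tpair0r rpred0.
- by rewrite tpairBr rpredB.
by apply: span_gen; exists (i1 + i2)%N, (j1 + j2)%N; exact: tens_gr_pair.
Qed.

Variables (p : nat -> nat -> {additive M -> M}) (p' : nat -> nat -> {additive N -> N}).
Hypotheses (pP : graded_proj g p) (pP' : graded_proj g' p').

Let q i j (k : nat * nat) := tens_map (p k.1 k.2) (p' (i - k.1)%N (j - k.2)%N).

Let qE i j k i1 j1 i2 j2 x y : x \in g i1 j1 -> y \in g' i2 j2 ->
  q i j k (tpair x y) = if [&& k.1 == i1, k.2 == j1, (i - k.1)%N == i2 & (j - k.2)%N == j2]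
    then tpair x y else 0.
Proof.
case: pP pP' => _ pid p0 [_ pid' p0'] xg yg; rewrite /q tens_map_pair.
case: k => k l /=; case: (boolP ((i1 == k) && (j1 == l))) => [/andP[/eqP <- /eqP <-]|].
  rewrite !eqxx /= pid //; case: ifP => [/andP[/eqP -> /eqP ->]|nkl]; first by rewrite pid'.
  by rewrite (p0' _ _ _ _ _ yg) ?tpair0r // [i2 == _]eq_sym [j2 == _]eq_sym.
move=> /negbTE nkl; rewrite (p0 _ _ _ _ _ xg) // tpair0l.
by rewrite [k == _]eq_sym [l == _]eq_sym andbA nkl.
Qed.

(** The projection of the tensor product onto bidegree (i, j): on a tensor of homogeneous elements
    at most one term survives, the one whose left bidegree matches. *)
Let P i j (t : tens M N) : tens M N :=
  \sum_(k : 'I_i.+1 * 'I_j.+1) q i j (k.1 : nat, k.2 : nat) t.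

Let PB i j : zmod_morphism (P i j).
Proof. by move=> s t; rewrite /P -sumrB; apply: eq_bigr => k _; rewrite /q raddfB. Qed.

Let P_piece i j (k : 'I_i.+1 * 'I_j.+1) t :
  q i j (k.1 : nat, k.2 : nat) t \in piece i j (k.1 : nat, k.2 : nat).
Proof.
case: pP pP' => pg _ _ [pg' _ _].
move: t; apply: tens_ind => [|s t hs ht|x y]; rewrite /q.
- by rewrite raddf0 rpred0.
- by rewrite raddfB rpredB.
by rewrite tens_map_pair; apply: span_gen; exists (p k.1 k.2 x), (p' (i - k.1)%N (j - k.2)%N y).
Qed.

Let piece_sub i j (k : 'I_i.+1 * 'I_j.+1) t :
  t \in piece i j (k.1 : nat, k.2 : nat) -> t \in tens_gr g g' i j.
Proof.
apply: span_sub => _ [x [y [xg yg ->]]].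
rewrite -[i in tens_gr _ _ i](@subnKC k.1) -1?ltnS //.
by rewrite -[j in tens_gr _ _ _ j](@subnKC k.2) -1?ltnS //; apply: tens_gr_pair.
Qed.

Let P_id i j t : t \in tens_gr g g' i j -> P i j t = t.
Proof.
move: t; apply: span_ind => [|s t hs ht|_ [i1 [j1 [i2 [j2 [x [y [xg yg <- <- ->]]]]]]]].
- exact: (raddf0 (zadd (PB i j))).
- by rewrite PB hs ht.
have hi : (i1 < (i1 + i2).+1)%N by rewrite ltnS leq_addr.
have hj : (j1 < (j1 + j2).+1)%N by rewrite ltnS leq_addr.
rewrite /P (bigD1 (Ordinal hi, Ordinal hj)) //= big1 ?addr0 => [|[k l] ne].
  by rewrite (qE _ _ _ xg yg) /= !addKn !eqxx.
rewrite (qE _ _ _ xg yg) /= ifF //; apply: contraNF ne => /and3P[/eqP k1 /eqP l1 _].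
by apply/eqP; congr pair; apply: val_inj.
Qed.

Let P_0 i j k l t : t \in tens_gr g g' k l -> (k == i) && (l == j) = false -> P i j t = 0.
Proof.
move=> tg nkl; move: t tg.
apply: span_ind => [|s t hs ht|_ [i1 [j1 [i2 [j2 [x [y [xg yg eqi eqj ->]]]]]]]].
- exact: (raddf0 (zadd (PB i j))).
- by rewrite PB hs ht subrr.
rewrite /P big1 // => -[u v] _; rewrite (qE _ _ _ xg yg) /= ifF //.
apply: contraFF nkl => /and4P[/eqP ui /eqP vj /eqP iu /eqP jv].
by rewrite -eqi -eqj -ui -vj -iu -jv !subnKC ?eqxx // -ltnS.
Qed.

Lemma tens_graded_proj : graded_proj (tens_gr g g') (fun i j => zadd (PB i j)).
Proof.
split=> [i j t|i j t|i j k l t] /=; [|exact: P_id|exact: P_0].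
by apply: rpred_sum => k _; apply: piece_sub; exact: P_piece.
Qed.

(** Bidegree (i, j) is the direct sum over the ways to split it between the factors, so ranks
    convolve exactly like coefficients of a product of power series. *)
Lemma tens_piece_rank (r r' : nat -> nat -> nat) i j :
  (forall i j, has_rank (g i j) (r i j)) -> (forall i j, has_rank (g' i j) (r' i j)) ->
  has_rank (tens_gr g g' i j)
    (\sum_(k : 'I_i.+1 * 'I_j.+1) r k.1 k.2 * r' (i - k.1) (j - k.2)).
Proof.
move=> gr gr'; case: (pP) (pP') => pg pid p0 [pg' pid' p0'].
apply: (@rank_direct_sum _ _ _ (fun k : 'I_i.+1 * 'I_j.+1 => piece i j (k.1 : nat, k.2 : nat))
  _ (fun k : 'I_i.+1 * 'I_j.+1 => q i j (k.1 : nat, k.2 : nat))).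
- move=> k; apply: (@tens_span_rank _ _ _ _ (p k.1 k.2) (p' (i - k.1)%N (j - k.2)%N)) => //.
  + exact: pid.
  + exact: pid'.
- by move=> k t; exact: piece_sub.
- move=> k; apply: span_ind => [|s t hs ht|_ [x [y [xg yg ->]]]].
  + by rewrite /q raddf0.
  + by rewrite /q raddfB [X in X - _]hs [X in _ - X]ht.
  + by rewrite [LHS](qE i j (k.1 : nat, k.2 : nat) xg yg) /= !eqxx.
- move=> k l t tk kl; move: t tk.
  apply: span_ind => [|s t hs ht|_ [x [y [xg yg ->]]]].
  + by rewrite /q raddf0.
  + by rewrite /q raddfB [X in X - _]hs [X in _ - X]ht subrr.
  + rewrite [LHS](qE i j (l.1 : nat, l.2 : nat) xg yg) /= ifF //.
    apply: contraNF kl => /and3P[/eqP k1 /eqP l1 _].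
    by apply/eqP; case: k l k1 l1 {xg yg} => [k1 k2] [l1 l2] /= e1 e2;
      congr pair; apply: val_inj.
- move=> t tg; split=> [|k]; last exact: P_piece.
  by rewrite -[LHS](P_id tg).
Qed.

End TensorGrading.

Lemma tens_has_qdim (M N : zmodType) (g : bigrading M) (g' : bigrading N) Q Q' :
  has_qdim g Q -> has_qdim g' Q' -> has_qdim (tens_gr g g') (Q * Q').
Proof.
move=> [gb gQ] [gb' gQ'].
have [p pP] := is_bigraded_proj gb; have [p' pP'] := is_bigraded_proj gb'.
split=> [|i j].
  apply: is_bigraded_intro (tens_graded_proj pP pP') _.
  by apply: tens_gr_gen; exact: is_bigraded_gen.
have ranks (L : zmodType) (h : bigrading L) H : (forall i j, exists2 r : nat,
    has_rank (h i j) r & fcoef (fcoef H i) j = r%:Z) ->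
    exists r : nat -> nat -> nat, (forall i j, has_rank (h i j) (r i j)) /\
      (forall i j, fcoef (fcoef H i) j = (r i j)%:Z).
  move=> hH; have /choice[r rP] a : exists r : nat -> nat, forall j,
      has_rank (h a j) (r j) /\ fcoef (fcoef H a) j = (r j)%:Z.
    have /choice[r rP] b : exists r, has_rank (h a b) r /\ fcoef (fcoef H a) b = r%:Z.
      by have [r] := hH a b; exists r.
    by exists r.
  by exists r; split=> a b; case: (rP a b).
have [[r [gr Qr]] [r' [gr' Qr']]] := (ranks _ _ _ gQ, ranks _ _ _ gQ').
exists (\sum_(k : 'I_i.+1 * 'I_j.+1) r k.1 k.2 * r' (i - k.1) (j - k.2))%N.
  exact: tens_piece_rank pP pP' _ _ _ _ gr gr'.
rewrite /= fcoef_sum.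
rewrite -(pair_bigA _ (fun (k : 'I_i.+1) (l : 'I_j.+1) => r k l * r' (i - k) (j - l)))%N /=.
rewrite (big_morph Posz PoszD (erefl _)); apply: eq_bigr => k _.
rewrite (big_morph Posz PoszD (erefl _)); apply: eq_bigr => l _.
by rewrite Qr Qr' PoszM.
Qed.

Lemma bigraded_iso_can (M N : zmodType) (g : bigrading M) (g' : bigrading N)
  (f : {additive M -> N}) (f' : {additive N -> M}) :
  cancel f f' -> cancel f' f -> degree_preserving g g' f -> degree_preserving g' g f' ->
  bigraded_iso g g' f.
Proof.
move=> fK f'K fg f'g; split=> [|i j x]; first by exists f'.
by apply/idP/idP => [/f'g|/fg //]; rewrite fK.
Qed.

Lemma bigraded_iso_inv (M N : zmodType) (g : bigrading M) (g' : bigrading N)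
  (f : {additive M -> N}) : bigraded_iso g g' f ->
  exists f' : {additive N -> M}, [/\ cancel f f', cancel f' f & degree_preserving g' g f'].
Proof.
case=> -[f' fK f'K] fg.
have f'B : zmod_morphism f' by move=> x y; apply: (can_inj fK); rewrite raddfB !f'K.
by exists (zadd f'B); split=> // i j x xg /=; rewrite -fg f'K.
Qed.

Lemma has_qdim_iso (M N : zmodType) (g : bigrading M) (g' : bigrading N)
  (f : {additive M -> N}) Q : bigraded_iso g g' f -> has_qdim g Q -> has_qdim g' Q.
Proof.
move=> fiso [[gsum guniq] gQ]; have [fbij fg] := fiso.
have [f' [fK f'K f'g]] := bigraded_iso_inv fiso; split; last first.
  by move=> i j; have [r gr Qr] := gQ i j; exists r => //; exact: has_rank_bij fbij (fg i j) gr.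
split=> [x|N' h hg h0 i j iN jN].
  have [n [h [hg xE]]] := gsum (f' x); exists n, (fun i j => f (h i j)).
  split=> [i j|]; first by rewrite fg.
  rewrite -[LHS]f'K xE raddf_sum; apply: eq_bigr => i _.
  by rewrite raddf_sum.
apply: (can_inj f'K); rewrite raddf0.
apply: (guniq N' (fun i j => f' (h i j))) => // [k l|].
  by apply: f'g; exact: hg.
apply: etrans (raddf0 f'); rewrite -[in RHS]h0 raddf_sum; apply: eq_bigr => k _.
by rewrite raddf_sum.
Qed.

(** * Tensor powers: splitting off a factor, and reindexing *)

Lemma tpow_ind (I : finType) (M : zmodType) (P : tpow I M -> Prop) :
  P 0 -> (forall x y, P x -> P y -> P (x - y)) -> (forall a, P (tpure a)) ->
  forall t, P t.
Proof. exact: presented_ind. Qed.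

Section TensorPowerSplit.
Variables (M : zmodType) (g : bigrading M) (n : nat).

Definition fcons (T : Type) (x : T) (a : 'I_n -> T) (i : 'I_n.+1) : T :=
  oapp a x (unlift ord0 i).

Lemma fcons0 T (x : T) a : fcons x a ord0 = x.
Proof. by rewrite /fcons unlift_none. Qed.

Lemma fconsS T (x : T) a i : fcons x a (fintype.lift ord0 i) = a i.
Proof. by rewrite /fcons liftK. Qed.

Let hd_tl (a : {ffun 'I_n.+1 -> M}) : tens M (tpow 'I_n M) :=
  tpair (a ord0) (tpure [ffun i => a (fintype.lift ord0 i)]).

Let hd_tl_multiadditive : multiadditive hd_tl.
Proof.
move=> a c x y; rewrite /hd_tl !ffunE; case: (unliftP ord0 c) => [j|] ->.
  have e z : [ffun i => upd a (fintype.lift ord0 j) z (fintype.lift ord0 i)] =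
      upd [ffun i => a (fintype.lift ord0 i)] j z.
    by apply/ffunP => i; rewrite !ffunE (inj_eq (@lift_inj _ ord0)).
  by rewrite !e (negbTE (neq_lift _ _)) tpureD tpairDr.
have e z : [ffun i => upd a ord0 z (fintype.lift ord0 i)] = [ffun i => a (fintype.lift ord0 i)].
  by apply/ffunP => i; rewrite !ffunE eq_sym (negbTE (neq_lift _ _)).
by rewrite !e eqxx tpairDl.
Qed.

Let split := zadd (tpow_lift_additive hd_tl_multiadditive).

Let consf x a : tpow 'I_n.+1 M := tpure (finfun (fcons x (a : {ffun 'I_n -> M}))).

Let consf_multiadditive x : multiadditive (consf x).
Proof.
move=> a c y z; rewrite /consf.
have e u : finfun (fcons x (upd a c u)) = upd (finfun (fcons x a)) (fintype.lift ord0 c) u.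
  apply/ffunP => i; rewrite !ffunE; case: (unliftP ord0 i) => [j|] ->.
    by rewrite !fconsS !ffunE (inj_eq (@lift_inj _ ord0)).
  by rewrite !fcons0 (negbTE (neq_lift _ _)).
by rewrite !e tpureD.
Qed.

Let consfDl x y a : consf (x + y) a = consf x a + consf y a.
Proof.
rewrite /consf; have e u : finfun (fcons u a) = upd (finfun (fcons 0 a)) ord0 u.
  apply/ffunP => i; rewrite !ffunE; case: (unliftP ord0 i) => [j|] ->.
    by rewrite !fconsS eq_sym (negbTE (neq_lift _ _)).
  by rewrite !fcons0 eqxx.
by rewrite !(e (_ + _), e x, e y) tpureD.
Qed.

Let consf_biadditive : biadditive (fun x t => zadd (tpow_lift_additive (consf_multiadditive x)) t).
Proof.
split=> x y z; last by rewrite raddfD.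
move: z; apply: tpow_ind => [|s t hs ht|a]; first by rewrite !raddf0 addr0.
  by rewrite !raddfB hs ht opprD addrACA.
by rewrite /= !tpow_lift_pure // consfDl.
Qed.

Let join := zadd (tens_lift_additive consf_biadditive).

Let split_pure a : split (tpure a) = hd_tl a.
Proof. exact: tpow_lift_pure. Qed.

Let join_pure x a : join (tpair x (tpure a)) = consf x a.
Proof. by rewrite /= tens_lift_pair //= tpow_lift_pure. Qed.

Let splitK : cancel split join.
Proof.
apply: tpow_ind => [|s t hs ht|a]; first by rewrite !raddf0.
  by rewrite !raddfB hs ht.
rewrite split_pure join_pure; congr tpure; apply/ffunP => i; rewrite !ffunE.
by case: (unliftP ord0 i) => [j|] ->; rewrite ?fconsS ?fcons0 // ffunE.
Qed.

Let joinK : cancel join split.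
Proof.
apply: tens_ind => [|s t hs ht|x]; first by rewrite !raddf0.
  by rewrite !raddfB hs ht.
apply: tpow_ind => [|s t hs ht|a]; first by rewrite tpair0r !raddf0.
  by rewrite tpairBr !raddfB hs ht.
rewrite join_pure split_pure /hd_tl ffunE fcons0; congr tpair; congr tpure.
by apply/ffunP => i; rewrite !ffunE fconsS.
Qed.

(** Splitting off factor [ord0] and putting it back are mutually inverse on pure tensors. This is
    the inductive step for the q-dimension of a power. *)
Lemma tpow_split : exists f : {additive tens M (tpow 'I_n M) -> tpow 'I_n.+1 M},
  bigraded_iso (tens_gr g (tpow_gr 'I_n g)) (tpow_gr 'I_n.+1 g) f.
Proof.
exists join; apply: bigraded_iso_can joinK splitK _ _ => i j t.
  move: t; apply: span_ind => [|s t hs ht|_ [i1 [j1 [i2 [j2 [x [y [xg yg <- <- ->]]]]]]]].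
  - by rewrite raddf0 rpred0.
  - by rewrite raddfB rpredB.
  move: y yg; apply: span_ind => [|s t hs ht|_ [p [q [a [ag <- <- ->]]]]].
  - by rewrite tpair0r raddf0 rpred0.
  - by rewrite tpairBr raddfB rpredB.
  rewrite join_pure; apply: span_gen.
  exists (fcons i1 p), (fcons j1 q), (finfun (fcons x a)); split=> //.
  - by move=> c; rewrite ffunE; case: (unliftP ord0 c) => [k|] ->; rewrite ?fconsS ?fcons0.
  - by rewrite big_ord_recl fcons0; congr (_ + _)%N; apply: eq_bigr => k _; rewrite fconsS.
  - by rewrite big_ord_recl fcons0; congr (_ + _)%N; apply: eq_bigr => k _; rewrite fconsS.
move: t; apply: span_ind => [|s t hs ht|_ [p [q [a [ag <- <- ->]]]]].
- by rewrite raddf0 rpred0.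
- by rewrite raddfB rpredB.
rewrite split_pure !big_ord_recl; apply: tens_gr_pair => //; apply: span_gen.
exists (fun k => p (fintype.lift ord0 k)), (fun k => q (fintype.lift ord0 k)).
exists [ffun k => a (fintype.lift ord0 k)]; split=> // c.
by rewrite ffunE.
Qed.

End TensorPowerSplit.

Section TensorPowerZero.
Variables (M : zmodType) (g : bigrading M).

Let a0 : {ffun 'I_0 -> M} := [ffun=> 0].

Let all_a0 (a : {ffun 'I_0 -> M}) : a = a0.
Proof. by apply/ffunP => -[]. Qed.

Let gr00 (t : tpow 'I_0 M) : t \in tpow_gr 'I_0 g 0%N 0%N.
Proof.
move: t; apply: tpow_ind => [|s t hs ht|a]; rewrite ?rpred0 ?rpredB //.
apply: span_gen; exists (fun=> 0%N), (fun=> 0%N), a.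
by rewrite !big_ord0; split=> // -[].
Qed.

Let gr_pos i j (t : tpow 'I_0 M) : t \in tpow_gr 'I_0 g i j ->
  (i == 0%N) && (j == 0%N) = false -> t = 0.
Proof.
move=> tg nij; move: t tg; apply: span_ind => [|s t -> ->|]; [by [] | by rewrite subrr |].
by move=> t [p [q [a [_ pi qj _]]]]; move: nij; rewrite -pi -qj !big_ord0.
Qed.

Let p i j (t : tpow 'I_0 M) : tpow 'I_0 M :=
  if (i == 0%N) && (j == 0%N) then t else 0.

Let pB i j : zmod_morphism (p i j).
Proof. by move=> s t; rewrite /p; case: ifP => _; rewrite ?subrr. Qed.

Lemma tpow0_has_qdim : has_qdim (tpow_gr 'I_0 g) 1.
Proof.
split.
  apply: (@is_bigraded_intro _ _ (fun i j => zadd (pB i j))); last first.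
    by move=> t; apply: span_gen; exists 0%N, 0%N; exact: gr00.
  split=> [i j t|i j t tg|i j k l t tg nkl] /=; rewrite /p.
  - by case: ifP => [/andP[/eqP -> /eqP ->]|_]; rewrite ?rpred0 ?gr00.
  - by case: ifP => // /(gr_pos tg) ->.
  - case: ifP => // /andP[/eqP i0 /eqP j0]; apply: gr_pos tg _.
    by rewrite -nkl i0 j0.
move=> i j; case: (boolP ((i == 0%N) && (j == 0%N))) => [/andP[/eqP -> /eqP ->]|/negbTE nij].
  exists 1%N => //; exists (fun=> tpure a0); split=> [k|c|t _]; first exact: gr00.
    (* On the empty index type the constant function 1 is vacuously multiadditive; its lift to the
       integers shows that the unique pure tensor has infinite order. *)
    have h1 : @multiadditive 'I_0 M int (fun=> 1) by move=> a [].
    rewrite big_ord1 => c0 k; rewrite ord1.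
    have := congr1 (zadd (tpow_lift_additive h1)) c0.
    by rewrite raddf0 raddfMz /= tpow_lift_pure // intz.
  exists 1 => //; move: t; apply: tpow_ind => [|s t [c cE] [d dE]|a].
  - by exists (fun=> 0); rewrite big1 ?mulr1z.
  - exists (fun k => c k - d k); rewrite mulrzBl cE dE -sumrB.
    by apply: eq_bigr => k _; rewrite mulrzBr.
  - by exists (fun=> 1); rewrite big_ord1 [a]all_a0.
exists 0%N; last first.
  by move: nij; case: i => [|i] //; case: j.
exists (fun=> 0); split=> [[]//|c _ []//|t tg]; exists 1 => //; exists (fun=> 0).
by rewrite big_ord0 (gr_pos tg).
Qed.

End TensorPowerZero.

Lemma tpow_ord_has_qdim (M : zmodType) (g : bigrading M) Q n :
  has_qdim g Q -> has_qdim (tpow_gr 'I_n g) (Q ^+ n).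
Proof.
move=> gQ; elim: n => [|n IH]; first by rewrite expr0; exact: tpow0_has_qdim.
have [f fiso] := tpow_split g n; apply: has_qdim_iso fiso _.
by rewrite exprS; exact: tens_has_qdim.
Qed.

Section TensorMulTheory.
Variables (A : comPzRingType) (g : bigrading A) (gA : is_bigraded_ring g).

Lemma tpow_mul_comp (I J K : finType) (p : I -> J) (q : J -> K) t :
  tpow_mul q (tpow_mul p t) = tpow_mul (q \o p) t :> tpow K A.
Proof.
move: t; apply: tpow_ind => [|s t hs ht|a]; first by rewrite !raddf0.
  by rewrite !raddfB /= hs ht.
rewrite !tpow_mul_pure; congr tpure; apply/ffunP => k; rewrite !ffunE.
rewrite [RHS](partition_big p (fun j => q j == k)) //=; apply: eq_bigr => j /eqP qj.
rewrite ffunE; apply: eq_bigl => i; case: eqP => [->|]; by rewrite ?qj ?eqxx ?andbF.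
Qed.

Lemma tpow_mul_id (I : finType) (p : I -> I) (t : tpow I A) :
  p =1 id -> tpow_mul p t = t.
Proof.
move=> pid; move: t; apply: tpow_ind => [|s t hs ht|a]; first by rewrite !raddf0.
  by rewrite !raddfB /= hs ht.
rewrite !tpow_mul_pure; congr tpure; apply/ffunP => k; rewrite !ffunE.
by rewrite (eq_bigl (pred1 k)) ?big_pred1_eq // => i; rewrite pid.
Qed.

Lemma eq_tpow_mul (I J : finType) (p q : I -> J) :
  p =1 q -> tpow_mul p =1 tpow_mul q :> (tpow I A -> tpow J A).
Proof. by move=> pq; have -> : p = q by apply/funext. Qed.

(** The product starts from a homogeneous [x], so that the degree of 1 never enters, even when the
    remaining product is empty. *)
Lemma homog_prod (I : Type) (r : seq I) (P : pred I) (a : I -> A) (d e : I -> nat)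
  i j x : x \in g i j -> (forall k, a k \in g (d k) (e k)) ->
  x * \prod_(k <- r | P k) a k \in
    g (i + \sum_(k <- r | P k) d k)%N (j + \sum_(k <- r | P k) e k)%N.
Proof.
move=> xg ag; elim: r i j x xg => [|k r IH] i j x xg.
  by rewrite !big_nil mulr1 !addn0.
rewrite !big_cons; case: ifP => _; last exact: IH.
by rewrite mulrA !addnA; apply: IH; apply: (proj2 gA).
Qed.

(* Surjectivity of p means that no empty product, i.e. no 1, is involved. *)
Lemma tpow_mul_degree (I J : finType) (p : I -> J) (p' : J -> I) : cancel p' p ->
  degree_preserving (tpow_gr I g) (tpow_gr J g) (tpow_mul p).
Proof.
move=> p'K i j; apply: span_ind => [|s t hs ht|_ [d [e [a [ag <- <- ->]]]]].
- by rewrite raddf0 rpred0.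
- by rewrite raddfB rpredB.
rewrite tpow_mul_pure; apply: span_gen.
exists (fun j => \sum_(i | p i == j) d i)%N, (fun j => \sum_(i | p i == j) e i)%N.
exists (fibre_prod p a); split=> //.
- move=> k; have splitE (h : I -> nat) : (\sum_(i | p i == k) h i =
      h (p' k) + \sum_(i | (p i == k) && (i != p' k)) h i)%N.
    by rewrite (bigD1 (p' k)) // p'K.
  rewrite ffunE (bigD1 (p' k)) ?p'K // !splitE; exact: homog_prod.
- by rewrite [RHS](partition_big p predT).
- by rewrite [RHS](partition_big p predT).
Qed.

Lemma tpow_mul_iso (I J : finType) (p : I -> J) : bijective p ->
  bigraded_iso (tpow_gr I g) (tpow_gr J g) (tpow_mul p : {additive tpow I A -> tpow J A}).
Proof.
case=> p' pK p'K.
apply: (@bigraded_iso_can _ _ _ _ _ (tpow_mul p' : {additive tpow J A -> tpow I A})) => [t|t||].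
- by rewrite /= tpow_mul_comp tpow_mul_id.
- by rewrite /= tpow_mul_comp tpow_mul_id.
- exact: tpow_mul_degree p'K.
- exact: tpow_mul_degree pK.
Qed.

Lemma tpow_has_qdim (I : finType) Q : has_qdim g Q -> has_qdim (tpow_gr I g) (Q ^+ #|I|).
Proof.
move=> gQ; apply: has_qdim_iso (tpow_ord_has_qdim #|I| gQ).
by apply: (tpow_mul_iso (p := enum_val)); exists enum_rank; [exact: enum_valK | exact: enum_rankK].
Qed.

End TensorMulTheory.

(** * Direct sums and the chain complex *)

Section DirectSumTheory.
Variables (I : finType) (M : I -> zmodType).

Lemma dsum_sumE J r (P : pred J) (F : J -> dsum M) u :
  (\sum_(j <- r | P j) F j) u = \sum_(j <- r | P j) F j u.
Proof. by elim/big_rec2: _ => // j x y _ <-. Qed.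

Definition dinj (u : I) (x : M u) : dsum M := fun v => transport M v x.

Lemma dinj_additive u : zmod_morphism (@dinj u).
Proof.
by move=> x y; apply: functional_extensionality_dep => v; rewrite /dinj raddfB.
Qed.

HB.instance Definition _ u :=
  GRing.isZmodMorphism.Build (M u) (dsum M) (@dinj u) (@dinj_additive u).

Lemma transport_ne (J : eqType) (F : J -> zmodType) (i j : J) (x : F i) :
  i != j -> transport F j x = 0.
Proof. by rewrite /transport; case: eqP. Qed.

Lemma dsum_dinj (x : dsum M) : x = \sum_u dinj (x u).
Proof.
apply: functional_extensionality_dep => v; rewrite dsum_sumE (bigD1 v) //=.
rewrite /dinj transport_id big1 ?addr0 // => u uv; exact: transport_ne.
Qed.

Variables (g : forall i, bigrading (M i)) (Q : I -> fps (fps int)).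
Hypothesis gQ : forall u, has_qdim (g u) (Q u).

Lemma dinj_gr u i j x : x \in g u i j -> dinj x \in dsum_gr g i j.
Proof.
move=> xg; rewrite inE; apply/forallP => v; rewrite /dinj.
have [<-|ne] := eqVneq u v; first by rewrite transport_id.
by rewrite transport_ne ?rpred0.
Qed.

Lemma dsum_has_qdim : has_qdim (dsum_gr g) (\sum_u Q u).
Proof.
have [p pP] : exists p : forall u, nat -> nat -> {additive M u -> M u},
    forall u, graded_proj (g u) (p u).
  exists (fun u => projT1 (cid (is_bigraded_proj (proj1 (gQ u))))) => u.
  by case: cid.
split.
  have PB i j : zmod_morphism (fun (x : dsum M) => (fun u => p u i j (x u)) : dsum M).
    move=> x y; apply: functional_extensionality_dep => u.
    exact: (raddfB (p u i j)).
  apply: (@is_bigraded_intro _ _ (fun i j => zadd (PB i j))).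
    split=> [i j x|i j x|i j k l x] /=; rewrite ?inE.
    - by apply/forallP => u; case: (pP u).
    - move=> /forallP xg; apply: functional_extensionality_dep => u.
      by case: (pP u) => _ pid _; rewrite pid.
    - move=> /forallP xg nkl; apply: functional_extensionality_dep => u.
      by case: (pP u) => _ _ p0; apply: p0 (xg u) nkl.
  move=> x; rewrite (dsum_dinj x); apply: rpred_sum => u _.
  move: (is_bigraded_gen (proj1 (gQ u)) (x u)); move: (x u).
  apply: span_ind => [|y z hy hz|y [i [j yg]]].
  - by rewrite raddf0 rpred0.
  - by rewrite raddfB rpredB.
  - by apply: span_gen; exists i, j; exact: dinj_gr.
move=> i j.
have [r rP] : exists r : I -> nat, forall u,
    has_rank (g u i j) (r u) /\ fcoef (fcoef (Q u) i) j = (r u)%:Z.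
  have /choice[r rP] u : exists r, has_rank (g u i j) r /\ fcoef (fcoef (Q u) i) j = r%:Z.
    by have [r] := (proj2 (gQ u)) i j; exists r.
  by exists r.
exists (\sum_u r u)%N; last first.
  rewrite !fcoef_sum (big_morph Posz PoszD (erefl _)).
  by apply: eq_bigr => u _; case: (rP u).
have PB u : zmod_morphism (fun x : dsum M => dinj (x u)).
  by move=> x y; rewrite -dinj_additive.
(* The summands must be subgroups of the direct sum itself, hence the images of the pieces under
   [dinj]. *)
apply: (@rank_direct_sum _ _ _ (fun u => dirim_sub (@dinj u) (g u i j))
  _ (fun u => zadd (PB u))).
- move=> u; have [v [vS vI vQ]] := proj1 (rP u).
  have sumE c : dinj (\sum_k v k *~ c k) = \sum_k dinj (v k) *~ c k.
    rewrite raddf_sum; apply: eq_bigr => k _.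
    exact: raddfMz.
  exists (fun k => dinj (v k)); split=> [k|c c0|_ /asboolP[y /vQ[m m0 [c yE]] ->]].
  + by rewrite inE; apply/asboolP; exists (v k).
  + apply: vI; have := congr1 (fun x : dsum M => x u) c0.
    by rewrite -sumE /= /dinj transport_id.
  + exists m => //; exists c; rewrite -sumE -yE.
    by rewrite raddfMz.
- by move=> u _ /asboolP[y yg ->]; exact: dinj_gr.
- by move=> u _ /asboolP[y yg ->]; congr dinj; exact: transport_id.
- move=> u v _ /asboolP[y yg ->] uv.
  by apply: etrans (raddf0 (@dinj v)); congr dinj; exact: transport_ne.
- move=> x /forallP xg; split=> [|u]; first exact: dsum_dinj.
  by rewrite inE; apply/asboolP; exists (x u).
Qed.

End DirectSumTheory.

(** * Components, Betti numbers and the maps of single edges *)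

Section Components.
Variable G : mgraph.
Implicit Types s t u : {set edge G}.

Lemma comp_of_eq s v w : (comp_of s v == comp_of s w) = connect (adj s) v w.
Proof. by rewrite -(inj_eq val_inj) /= root_connect //; exact/sym_connect_sym/adj_sym. Qed.

Lemma comp_of_val s (c : component s) : comp_of s (val c) = c.
Proof. by apply: val_inj => /=; apply/eqP; exact: (valP c). Qed.

Lemma adj_subset s t : s \subset t -> subrel (connect (adj s)) (connect (adj t)).
Proof.
move=> /subsetP st; apply: connect_sub => v w /existsP[a /andP[sa vw]].
by apply: connect1; apply/existsP; exists a; rewrite st.
Qed.

(** A component is stored as its root, but root and vertex are connected in [s], hence also in [t].
    All later identities of component maps reduce to this one. *)
Lemma component_map_comp_of s t v : s \subset t ->
  component_map t (comp_of s v) = comp_of t v.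
Proof.
move=> st; apply/eqP; rewrite comp_of_eq; apply: (adj_subset st).
by rewrite -comp_of_eq comp_of_val.
Qed.

Lemma component_map_id s : @component_map G s s =1 id.
Proof. exact: comp_of_val. Qed.

Lemma component_map_surj s t : s \subset t ->
  cancel (fun c : component t => comp_of s (val c)) (@component_map G s t).
Proof. by move=> st c; rewrite component_map_comp_of ?comp_of_val. Qed.

Lemma b1_setU1 s a : a \notin s -> b1 (a |: s) = (joins_itself s a + b1 s)%N.
Proof.
move=> sa; case: (boolP (joins_itself s a)) => j; first by rewrite b1_self.
by rewrite b1_join.
Qed.

Lemma b1_leq s a : a \notin s -> (b1 s <= b1 (a |: s))%N.
Proof. by move=> sa; rewrite b1_setU1 ?leq_addl. Qed.

End Components.

Section EdgeMaps.
Variables (A : comPzRingType) (gA : bigrading A) (B : zmodType) (gB : bigrading B).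
Variable f : forall k : nat, {additive tpow 'I_k B -> tpow 'I_k.+1 B}.
Hypothesis hA : is_bigraded_ring gA.
Hypothesis hf : forall k, degree_preserving (tpow_gr 'I_k gB) (tpow_gr 'I_k.+1 gB) (f k).

Definition powB (k : nat) : zmodType := tpow 'I_k B.

(** Carrying the exponent along with the element turns the family [f] into one self-map, which can
    be iterated without transports. *)
Definition step (u : {k : nat & powB k}) : {k : nat & powB k} :=
  Tagged powB (f (tag u) (tagged u)).

Lemma Tagged_transport k l (x : powB k) : k = l -> Tagged powB (transport powB l x) = Tagged powB x.
Proof. by move=> kl; case: l / kl; rewrite transport_id. Qed.

Lemma Tagged_transport_eq k l (x : powB k) (y : powB l) :
  Tagged powB x = Tagged powB y -> transport powB l x = y.
Proof.
by move=> /(congr1 (fun u => transport powB l (tagged u))) /= ->; rewrite transport_id.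
Qed.

Lemma transport_gr k l (x : powB k) i j : x \in tpow_gr 'I_k gB i j ->
  transport powB l x \in tpow_gr 'I_l gB i j.
Proof.
move=> xg; have [<-|ne] := eqVneq k l; first by rewrite transport_id.
by rewrite transport_ne ?rpred0.
Qed.

Section OneGraph.
Variable G : mgraph.
Implicit Types s t : {set edge G}.

(** The two cases of [B_map] merge, since b1 grows by one exactly when [f] is applied. Composites
    along different edges are then compared by counting iterations. *)
Lemma Tagged_B_map s a (x : powB (b1 s)) : a \notin s ->
  Tagged powB (B_map f a x) = iter (b1 (a |: s) - b1 s) step (Tagged powB x).
Proof.
move=> sa; rewrite /B_map; have [j|j] := boolP (joins_itself s a).
  by rewrite Tagged_transport b1_self // subSnn.
by rewrite Tagged_transport b1_join // subnn.
Qed.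

Lemma B_map_commute s a b (x : powB (b1 s)) : a \notin s -> b \notin s -> a != b ->
  transport powB (b1 (a |: (b |: s))) (B_map f b (B_map f a x)) = B_map f a (B_map f b x).
Proof.
move=> sa sb ab.
have sba : b \notin a |: s by rewrite !inE negb_or eq_sym ab.
have sab : a \notin b |: s by rewrite !inE negb_or ab.
apply: Tagged_transport_eq; rewrite !Tagged_B_map // -!iterD setUCA.
by rewrite !addnBA ?subnK ?b1_leq // setUCA b1_leq.
Qed.

(** On the A factors a transport along an equality of edge sets is itself a [component_map], so it
    composes with the others. *)
Lemma transport_state s t X Y : s = t ->
  transport (state A B (G := G)) t (tpair X Y : state A B s) =
  tpair (tpow_mul (@component_map G s t) X) (transport powB (b1 t) Y).
Proof.
move=> st; case: t / st; rewrite !transport_id tpow_mul_id //.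
exact: component_map_id.
Qed.

Lemma edge_map_pair s a X Y :
  edge_map f a (tpair X Y : state A B s) =
  (tpair (tpow_mul (@component_map G s (a |: s)) X) (B_map f a Y) : state A B (a |: s)).
Proof. exact: tens_map_pair. Qed.

(** On the A factors both composites collapse to the component map from s directly to the enlarged
    edge set. The transport accounts for the two ways of writing that set. *)
Lemma edge_map_commute s a b (y : state A B s) : a \notin s -> b \notin s -> a != b ->
  transport (state A B (G := G)) (a |: (b |: s)) (edge_map f b (edge_map f a y)) =
  edge_map f a (edge_map f b y).
Proof.
move=> sa sb ab; move: y; apply: tens_ind => [|x y hx hy|x y]; first by rewrite !raddf0.
  by rewrite !raddfB /= hx hy.
have st : b |: (a |: s) = a |: (b |: s) by exact: setUCA.
have E c d : edge_map f d (edge_map f c (tpair x y : state A B s)) = tpair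
    (tpow_mul (@component_map G s (d |: (c |: s))) x) (B_map f d (B_map f c y)).
  rewrite (edge_map_pair c x y); apply: etrans (edge_map_pair d _ _) _.
  congr tpair; rewrite (tpow_mul_comp (@component_map G s (c |: s))).
  by apply: eq_tpow_mul => v; rewrite /= component_map_comp_of ?subsetUr.
rewrite !E; apply: etrans (transport_state _ _ st) _; congr tpair.
  rewrite tpow_mul_comp; apply: eq_tpow_mul => v.
  by rewrite /= component_map_comp_of // st.
exact: B_map_commute.
Qed.

Lemma edge_map_degree s a : degree_preserving (state_gr gA gB s) (state_gr gA gB (a |: s))
  (@edge_map A B f G s a).
Proof.
move=> i j; apply: span_ind => [|x y hx hy|_ [i1 [j1 [i2 [j2 [x [y [xg yg <- <- ->]]]]]]]].
- by rewrite raddf0 rpred0.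
- by rewrite raddfB rpredB.
rewrite edge_map_pair; apply: tens_gr_pair.
  exact: tpow_mul_degree (component_map_surj (subsetUr _ _)) _ _ _ xg.
rewrite /B_map; case: ifP => _; apply: transport_gr => //; exact: hf.
Qed.

Lemma state_has_qdim s QA QB : has_qdim gA QA -> has_qdim gB QB ->
  has_qdim (state_gr gA gB s) (QA ^+ b0 s * QB ^+ b1 s).
Proof.
move=> AQ BQ; apply: tens_has_qdim; last exact: tpow_ord_has_qdim.
by rewrite -card_component; exact: tpow_has_qdim.
Qed.

Lemma chain_has_qdim i QA QB : has_qdim gA QA -> has_qdim gB QB ->
  has_qdim (chain_gr gA gB G i)
    (\sum_(s : states G i) QA ^+ b0 (val s) * QB ^+ b1 (val s)).
Proof. by move=> AQ BQ; apply: dsum_has_qdim => s; exact: state_has_qdim. Qed.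

End OneGraph.

End EdgeMaps.

(** * Signs, and the square of the differential *)

Section Signs.
Variable E : finType.
Implicit Types (s : {set E}) (pos : E -> nat).

(** The exponent of the differential, phrased through positions of edges so that two orderings can
    be compared on one set of edges. *)
Definition sgn pos s a : nat := \sum_(b in s) (pos b < pos a)%N.

Lemma sgn_setU1 pos s a c : c \notin s -> sgn pos (c |: s) a = ((pos c < pos a) + sgn pos s a)%N.
Proof. by move=> sc; rewrite /sgn big_setU1. Qed.

Definition inversions pos pos' s : nat :=
  \sum_(a in s) \sum_(b in s) ((pos a < pos b) && (pos' b < pos' a))%N.

Lemma odd_sum s (F H : E -> nat) : (forall b, b \in s -> odd (F b) = odd (H b)) ->
  odd (\sum_(b in s) F b) = odd (\sum_(b in s) H b).
Proof. by move=> FH; elim/big_rec2: _ => // b m n /FH sb; rewrite !oddD sb => ->. Qed.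

(* Adding c to s creates one inversion for every b in s whose order relative
   to c differs in pos and pos', which is what changes the sign at c. *)
Lemma sgn_inversions pos pos' s c : injective pos -> injective pos' -> c \notin s ->
  odd (inversions pos pos' (c |: s) + sgn pos s c) = odd (inversions pos pos' s + sgn pos' s c).
Proof.
move=> posI posI' sc; pose P a b := ((pos a < pos b) && (pos' b < pos' a))%N.
have -> : inversions pos pos' (c |: s) =
    (\sum_(b in s) (P c b + P b c) + inversions pos pos' s)%N.
  rewrite /inversions big_setU1 // big_setU1 //= ltnn /=.
  under [X in (_ + X)%N]eq_bigr do rewrite big_setU1 //=.
  by rewrite !big_split /= addnA.
rewrite addnAC -big_split /= addnC !oddD; congr (_ (+) _).
apply: odd_sum => b sb; rewrite /P.
have /negbTE bc : b != c by apply: contraNneq sc => <-.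
have := inj_eq posI b c; have := inj_eq posI' b c; rewrite bc.
by case: (ltngtP (pos b) (pos c)) => //; case: (ltngtP (pos' b) (pos' c)).
Qed.

End Signs.

Section Differential.
Variables (A : comPzRingType) (gA : bigrading A) (B : zmodType) (gB : bigrading B).
Variable f : forall k : nat, {additive tpow 'I_k B -> tpow 'I_k.+1 B}.
Hypothesis hA : is_bigraded_ring gA.
Hypothesis hf : forall k, degree_preserving (tpow_gr 'I_k gB) (tpow_gr 'I_k.+1 gB) (f k).
Variables (G : mgraph) (n : nat) (e : 'I_n -> edge G) (e' : edge G -> 'I_n).
Hypotheses (eK : cancel e e') (e'K : cancel e' e).
Implicit Types s t : {set edge G}.

Local Notation pos := (fun a => e' a : nat).
Local Notation st := (state A B (G := G)).

Lemma pos_inj : injective pos.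
Proof. by move=> a b /val_inj; exact: (can_inj e'K). Qed.

Lemma sign_expE s j : sign_exp e s j = sgn pos s (e j).
Proof.
rewrite /sign_exp /sgn -sum1_card big_mkcond [RHS]big_mkcond /=.
rewrite [RHS](reindex e); last by apply: onW_bij; exists e'.
by apply: eq_bigr => k _; rewrite inE !eK andbC; case: (e k \in s); case: (k < j)%N.
Qed.

(** [incl] already transports its argument to the index of each summand, so it absorbs a transport
    between equal edge sets. *)
Lemma incl_cast i t u (y : st t) (z : st u) : t = u -> transport st u y = z ->
  @incl A B G i _ y = @incl A B G i _ z.
Proof. by move=> tu; case: u / tu z => z; rewrite transport_id => ->. Qed.

Lemma incl_gr i t a b (y : st t) : y \in state_gr gA gB t a b ->
  @incl A B G i _ y \in chain_gr gA gB G i a b.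
Proof.
move=> yg; rewrite inE; apply/forallP => u; rewrite /incl.
have [tu|ne] := eqVneq t (val u); last by rewrite transport_ne ?rpred0.
by move: y yg; rewrite tu => y yg; rewrite transport_id.
Qed.

Lemma sum_incl i (x : chain A B G i) : x = \sum_(s : states G i) @incl A B G i _ (x s).
Proof.
apply: functional_extensionality_dep => v; rewrite dsum_sumE (bigD1 v) //=.
rewrite /incl transport_id big1 ?addr0 // => u uv; apply: transport_ne.
by apply: contraNneq uv => uvE; apply/eqP/val_inj.
Qed.

Lemma big_incl i (P : zmodType) (F : forall s, st s -> P) t (y : st t) :
  (forall s, zmod_morphism (F s)) -> #|t| = i ->
  \sum_(s : states G i) F (val s) (@incl A B G i _ y s) = F t y.
Proof.
move=> FB ti; pose u : states G i := exist _ t (introT eqP ti).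
rewrite (bigD1 u) //= [X in _ + X]big1 => [|s su].
  by rewrite addr0; congr F; exact: transport_id.
rewrite /incl transport_ne; first by rewrite -(subrr 0) FB subrr.
by apply: contraNneq su => tE; apply/eqP/val_inj.
Qed.

Lemma differentialE i (x : chain A B G i) : differential f e x =
  \sum_(s : states G i) \sum_(a | a \notin val s)
    @incl A B G i.+1 _ (edge_map f a (x s)) *~ (-1) ^+ sgn pos (val s) a.
Proof.
apply: eq_bigr => s _; rewrite [RHS](reindex e) /=.
  by apply: eq_bigr => j _; rewrite sign_expE.
by apply: onW_bij; exists e'.
Qed.

Lemma differential_incl i t (y : st t) : #|t| = i -> differential f e (@incl A B G i _ y) =
  \sum_(a | a \notin t) @incl A B G i.+1 _ (edge_map f a y) *~ (-1) ^+ sgn pos t a.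
Proof.
move=> ti; rewrite differentialE.
apply: (big_incl (F := fun s z => \sum_(a | a \notin s)
  @incl A B G i.+1 _ (edge_map f a z) *~ (-1) ^+ sgn pos s a)) => // s z w.
rewrite -sumrB; apply: eq_bigr => a _.
by rewrite raddfB incl_additive mulrzBl.
Qed.

Lemma differential_degree i : degree_preserving (chain_gr gA gB G i)
  (chain_gr gA gB G i.+1) (@differential A B f G n e i).
Proof.
move=> a b x /forallP xg; rewrite differentialE.
apply: rpred_sum => s _; apply: rpred_sum => c _; apply: rpredMz.
by apply: incl_gr; apply: edge_map_degree.
Qed.

Lemma differential_square i (x : chain A B G i) : differential f e (differential f e x) = 0.
Proof.
rewrite (differentialE x) raddf_sum big1 // => s _.
pose F a b := @incl A B G i.+2 _ (edge_map f b (edge_map f a (x s))) *~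
  (-1) ^+ (sgn pos (a |: val s) b + sgn pos (val s) a).
have cs a : a \notin val s -> #|a |: val s| = i.+1.
  by move=> sa; rewrite cardsU1 sa (eqP (valP s)).
transitivity (\sum_(a | a \notin val s) \sum_(b | b \notin a |: val s) F a b).
  rewrite raddf_sum; apply: eq_bigr => a sa; rewrite raddfMz /= differential_incl ?cs //.
  rewrite mulrz_suml; apply: eq_bigr => b _.
  by rewrite /F -mulrzA exprD.
have FN a b : a \notin val s -> b \notin val s -> (pos a < pos b)%N -> F b a = - F a b.
  move=> sa sb ltab; have ab : a != b by apply: contraTneq ltab => ->; rewrite ltnn.
  rewrite /F (incl_cast _ (setUCA _ _ _) (edge_map_commute f (x s) sa sb ab)).
  (* As [a] precedes [b], adding [a] raises the exponent at [b] by one, while adding [b] leaves the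
     exponent at [a] unchanged. *)
  rewrite !sgn_setU1 // ltab [(_ < _)%N]ltnNge (ltnW ltab) /= add0n add1n addSn exprS.
  by rewrite mulN1r mulrNz opprK addnC.
pose Pr := fun p : edge G * edge G => (p.1 \notin val s) && (p.2 \notin p.1 |: val s).
(* The ordered pairs of new edges are split by which edge comes first, and the second half is
   reindexed by the swap so that it cancels the first. *)
rewrite pair_big_dep /= (bigID (fun p => pos p.1 < pos p.2)%N) /=.
rewrite [X in _ + X](reindex (fun p : edge G * edge G => (p.2, p.1))) /=; last first.
  by apply: onW_bij; exists (fun p : edge G * edge G => (p.2, p.1)); case.
apply/eqP; rewrite addr_eq0 -sumrN; apply/eqP; apply: eq_big => [[a b]|[a b]] /=.
  rewrite !inE !negb_or [b == a]eq_sym; have [->|ab] := eqVneq a b.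
    by rewrite ltnn /= !andbF.
  have posE : (e' a == e' b :> nat) = (a == b) by exact: (inj_eq pos_inj).
  rewrite -leqNgt [RHS]andbC [in RHS]leq_eqVlt posE (negbTE ab) /=.
  by case: (a \in _); case: (b \in _); rewrite ?andbF ?andbT.
rewrite in_setU1 negb_or => /andP[/andP[sa /andP[_ sb]] ltab].
by rewrite (FN a b) ?opprK.
Qed.

End Differential.

(** * Invariance under graph isomorphism *)

Definition incidence_preserving (G G' : mgraph) (phi : vertex G -> vertex G')
    (psi : edge G -> edge G') : Prop :=
  forall a, (src (psi a) = phi (src a) /\ tgt (psi a) = phi (tgt a)) \/
            (src (psi a) = phi (tgt a) /\ tgt (psi a) = phi (src a)).

Lemma incidence_preserving_inv (G G' : mgraph) phi psi phi' psi' :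
  cancel phi phi' -> cancel psi' psi -> @incidence_preserving G G' phi psi ->
  @incidence_preserving G' G phi' psi'.
Proof.
move=> phiK psi'K inc a; have := inc (psi' a); rewrite psi'K.
by case=> -[-> ->]; rewrite !phiK; [left | right].
Qed.

Section ComponentImage.
Variables (G G' : mgraph) (phi : vertex G -> vertex G') (psi : edge G -> edge G').
Hypothesis inc : incidence_preserving phi psi.
Implicit Types s : {set edge G}.

Lemma connect_image s (s' : {set edge G'}) u v : psi @: s \subset s' ->
  connect (adj s) u v -> connect (adj s') (phi u) (phi v).
Proof.
move=> /subsetP ss' /connectP[p + ->]; elim: p u => [|w p IH] u /=; first by rewrite connect0.
case/andP => /existsP[a /andP[sa uw]] /IH; apply: connect_trans.
apply: connect1; apply/existsP; exists (psi a); rewrite ss' ?imset_f //=.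
by case/orP: uw => /andP[/eqP <- /eqP <-]; case: (inc a) => -[-> ->];
  rewrite !eqxx ?orbT.
Qed.

Definition component_image s (s' : {set edge G'}) (c : component s) : component s' :=
  comp_of s' (phi (val c)).

Lemma component_image_comp_of s (s' : {set edge G'}) v : psi @: s \subset s' ->
  component_image s' (comp_of s v) = comp_of s' (phi v).
Proof.
move=> ss'; apply/eqP; rewrite comp_of_eq; apply: (connect_image ss').
by rewrite -comp_of_eq comp_of_val.
Qed.

End ComponentImage.

Section ChainImage.
Variables (G G' : mgraph) (phi : vertex G -> vertex G') (psi : edge G -> edge G').
Variables (A : comPzRingType) (B : zmodType).

(** The target [s'] is left free instead of being the image of [s], so the inverse map can land in
    [s] itself and not in [psi' @: (psi @: s)]. *)
Definition state_image (s : {set edge G}) (s' : {set edge G'}) : state A B s -> state A B s' :=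
  tens_map (tpow_mul (@component_image G G' phi s s'))
    (transport (powB B) (b1 s') : {additive powB B (b1 s) -> powB B (b1 s')}).

HB.instance Definition _ s s' :=
  GRing.isZmodMorphism.Build (state A B s) (state A B s') (@state_image s s')
    (@tens_map_additive _ _ _ _ _ _).

Lemma state_image_pair (s : {set edge G}) (s' : {set edge G'}) X Y :
  state_image s' (tpair X Y : state A B s) =
  (tpair (tpow_mul (@component_image G G' phi s s') X) (transport (powB B) (b1 s') Y)
     : state A B s').
Proof. exact: tens_map_pair. Qed.

Variable eps : {set edge G} -> nat.

(** Degrees and invertibility do not depend on the sign exponents [eps]; compatibility with the
    differentials is what leads to inversion counts. *)
Definition chain_image i (x : chain A B G i) : chain A B G' i :=
  \sum_(s : states G i) @incl A B G' i _ (state_image (psi @: val s) (x s)) *~ (-1) ^+ eps (val s).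

Lemma chain_image_additive i : zmod_morphism (@chain_image i).
Proof.
move=> x y; rewrite /chain_image -sumrB; apply: eq_bigr => s _.
have -> : (x - y : chain A B G i) s = x s - y s by [].
by rewrite raddfB incl_additive mulrzBl.
Qed.

HB.instance Definition _ i := GRing.isZmodMorphism.Build (chain A B G i) (chain A B G' i)
  (@chain_image i) (@chain_image_additive i).

Lemma chain_image_incl i t (y : state A B t) : #|t| = i ->
  chain_image (@incl A B G i t y) =
  @incl A B G' i _ (state_image (psi @: t) y) *~ (-1) ^+ eps t.
Proof.
move=> ti; apply: (big_incl (F := fun s z =>
  @incl A B G' i _ (state_image (psi @: s) z) *~ (-1) ^+ eps s)) => // s z w.
by rewrite raddfB incl_additive mulrzBl.
Qed.

End ChainImage.

Section GraphIso.
Variables (G G' : mgraph) (phi : vertex G -> vertex G') (psi : edge G -> edge G').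
Variables (phi' : vertex G' -> vertex G) (psi' : edge G' -> edge G).
Hypotheses (phiK : cancel phi phi') (phi'K : cancel phi' phi).
Hypotheses (psiK : cancel psi psi') (psi'K : cancel psi' psi).
Hypothesis inc : incidence_preserving phi psi.
Implicit Types s t : {set edge G}.

Lemma imset_edgeK s : psi' @: (psi @: s) = s.
Proof. by rewrite -imset_comp (eq_imset _ psiK) imset_id. Qed.

Lemma joins_itself_image s a : joins_itself (psi @: s) (psi a) = joins_itself s a.
Proof.
rewrite !joins_itselfE.
have -> : connect (adj (psi @: s)) (src (psi a)) (tgt (psi a)) =
    connect (adj (psi @: s)) (phi (src a)) (phi (tgt a)).
  case: (inc a) => -[-> ->] //.
  exact/(sym_connect_sym (adj_sym _)).
apply/idP/idP; last exact: connect_image.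
rewrite -{2}[src a]phiK -{2}[tgt a]phiK; apply: connect_image.
  exact: incidence_preserving_inv inc.
by rewrite imset_edgeK.
Qed.

(* b1_self and b1_join determine b1 from connectivity, one edge at a time. *)
Lemma b1_image s : b1 (psi @: s) = b1 s.
Proof.
move: {2}#|s| (erefl #|s|) => m; elim: m s => [|m IH] s.
  move/eqP; rewrite cards_eq0 => /eqP ->; rewrite imset0.
  have b10 (H : mgraph) : b1 (set0 : {set edge H}) = 0%N.
    by apply/eqP; rewrite -leqn0 -(cards0 (edge H)) -b1E leq_addr.
  by rewrite !b10.
move=> sm; have /card_gt0P[a sa] : (0 < #|s|)%N by rewrite sm.
have na : a \notin s :\ a by rewrite !inE eqxx.
have npa : psi a \notin psi @: (s :\ a) by rewrite mem_imset //; exact: can_inj psiK.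
rewrite -(setD1K sa) imsetU1 !b1_setU1 // joins_itself_image IH //.
by apply/eqP; rewrite -eqSS -sm [X in _ == X](cardsD1 a) sa.
Qed.

Variables (A : comPzRingType) (gA : bigrading A) (B : zmodType) (gB : bigrading B).
Hypothesis hA : is_bigraded_ring gA.
Variable f : forall k : nat, {additive tpow 'I_k B -> tpow 'I_k.+1 B}.

Lemma state_image_degree s :
  degree_preserving (state_gr gA gB s) (state_gr gA gB (psi @: s))
    (@state_image G G' phi A B s (psi @: s)).
Proof.
move=> i j; apply: span_ind => [|x y hx hy|_ [i1 [j1 [i2 [j2 [x [y [xg yg <- <- ->]]]]]]]].
- by rewrite raddf0 rpred0.
- by rewrite raddfB rpredB.
rewrite state_image_pair; apply: tens_gr_pair; last exact: transport_gr.
apply: (tpow_mul_degree hA (p' := fun c => comp_of s (phi' (val c)))) xg => c.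
by rewrite (component_image_comp_of inc) // phi'K comp_of_val.
Qed.

(** On the A factors both sides send the component of v to the component of [phi v]; on the B
    factors both iterate [step] equally often, because b1 is preserved. *)
Lemma state_image_edge_map s a (y : state A B s) : a \notin s ->
  transport (state A B (G := G')) (psi a |: psi @: s)
    (state_image phi (psi @: (a |: s)) (edge_map f a y)) =
  edge_map f (psi a) (state_image phi (psi @: s) y).
Proof.
move=> sa; have st : psi @: (a |: s) = psi a |: psi @: s by exact: imsetU1.
have npa : psi a \notin psi @: s by rewrite mem_imset //; exact: can_inj psiK.
move: y; apply: tens_ind => [|x y hx hy|x y]; first by rewrite !raddf0.
  by rewrite !raddfB /= hx hy.
rewrite (edge_map_pair f a x y) (state_image_pair phi (psi @: s) x y).
rewrite (edge_map_pair f (psi a)).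
have -> := state_image_pair phi (psi @: (a |: s)) (tpow_mul (@component_map G s (a |: s)) x)
  (B_map f a y).
apply: etrans (transport_state _ _ st) _; congr tpair.
  rewrite !tpow_mul_comp; apply: eq_tpow_mul => c /=.
  rewrite (component_image_comp_of inc) // component_map_comp_of ?st //.
  by rewrite component_map_comp_of // subsetUr.
apply: (@Tagged_transport_eq B); rewrite (Tagged_B_map f _ npa) !Tagged_transport ?b1_image //.
by rewrite (Tagged_B_map f _ sa) -st !b1_image.
Qed.

Lemma state_image_cancel s (y : state A B s) :
  state_image phi' s (state_image phi (psi @: s) y) = y.
Proof.
move: y; apply: tens_ind => [|x y hx hy|x y]; first by rewrite !raddf0.
  by rewrite !raddfB /= hx hy.
rewrite (state_image_pair phi (psi @: s) x y).
apply: etrans (state_image_pair phi' s _ _) _; congr tpair.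
  rewrite tpow_mul_comp; apply: tpow_mul_id => c /=.
  rewrite (component_image_comp_of (incidence_preserving_inv phiK psi'K inc)) ?imset_edgeK //.
  by rewrite phiK comp_of_val.
by apply: (@Tagged_transport_eq B); rewrite Tagged_transport ?b1_image.
Qed.

Lemma chain_image_cancel (eps : {set edge G} -> nat) i (x : chain A B G i) :
  chain_image phi' psi' (fun r => eps (psi' @: r)) (chain_image phi psi eps x) = x.
Proof.
rewrite [chain_image phi psi eps x]/chain_image raddf_sum [RHS]sum_incl; apply: eq_bigr => s _.
rewrite raddfMz /= chain_image_incl; last first.
  by rewrite card_imset ?(eqP (valP s)) //; exact: can_inj psiK.
(* The sign of [s] occurs twice, once in each direction, and squares to 1. *)
rewrite imset_edgeK state_image_cancel -mulrzA -exprD addnn -mul2n exprM sqrrN.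
by rewrite !expr1n mulr1z.
Qed.

Variable eps : {set edge G} -> nat.

Lemma chain_image_degree i : degree_preserving (chain_gr gA gB G i) (chain_gr gA gB G' i)
  (@chain_image G G' phi psi A B eps i).
Proof.
move=> a b x /forallP xg; apply: rpred_sum => s _; apply: rpredMz.
by apply: incl_gr; exact: state_image_degree.
Qed.

Variables (n : nat) (e : 'I_n -> edge G) (d : edge G -> 'I_n).
Variables (e' : 'I_n -> edge G') (d' : edge G' -> 'I_n).
Hypotheses (eK : cancel e d) (dK : cancel d e) (e'K : cancel e' d') (d'K : cancel d' e').
Hypothesis epsE : forall s, eps s =
  inversions (fun a => d a : nat) (fun a => d' (psi a) : nat) s.

Lemma chain_image_differential i (x : chain A B G i) :
  chain_image phi psi eps (differential f e x) = differential f e' (chain_image phi psi eps x).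
Proof.
rewrite (differentialE f eK dK) !raddf_sum; apply: eq_bigr => s _.
rewrite raddf_sum raddfMz /= (differential_incl f e'K d'K); last first.
  by rewrite card_imset ?(eqP (valP s)) //; exact: can_inj psiK.
rewrite mulrz_suml [RHS](reindex psi) /=; last by apply: onW_bij; exists psi'.
apply: eq_big => [a|a sa]; first by rewrite mem_imset //; exact: can_inj psiK.
rewrite raddfMz /= chain_image_incl; last by rewrite cardsU1 sa (eqP (valP s)).
rewrite (incl_cast _ (imsetU1 _ _ _) (state_image_edge_map _ sa)) -!mulrzA -!exprD.
(* Only parities matter. Pulled back along [psi], the order of the target becomes a second position
   function on the edges of G, and [sgn_inversions] compares the two. *)
congr (_ *~ _); rewrite -signr_odd -[RHS]signr_odd !epsE; congr (_ ^+ _).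
have -> : sgn (fun b => d' b) (psi @: val s) (psi a) = sgn (fun b => d' (psi b)) (val s) a.
  by rewrite /sgn big_imset //= => b c _ _; exact: (can_inj psiK).
rewrite [(sgn _ _ _ + inversions _ _ _)%N]addnC.
apply: congr1; apply: sgn_inversions => //.
  by move=> b c /val_inj; exact: (can_inj dK).
by move=> b c /val_inj/(can_inj d'K)/(can_inj psiK).
Qed.

End GraphIso.

(** * Cohomology and Euler characteristic *)

Section CohomologyClass.
Variable K : precomplex.

Definition hclass i (z : cocycles K i) : cohomology K i :=
  \pi_(Quotient.quot (preim_sub (val : cocycles K i -> cobj K i) (coboundaries K i))) z.

Lemma hclass_additive i : zmod_morphism (@hclass i).
Proof. by move=> x y; rewrite /hclass raddfB. Qed.

HB.instance Definition _ i :=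
  GRing.isZmodMorphism.Build (cocycles K i) (cohomology K i) (@hclass i) (@hclass_additive i).

Lemma hclass_repr i (h : cohomology K i) : hclass (repr h) = h.
Proof. exact: reprK. Qed.

Lemma hclass_eq i (x y : cocycles K i) :
  (hclass x == hclass y) = (val x - val y \in coboundaries K i).
Proof. by rewrite /hclass -Quotient.idealrBE inE raddfB. Qed.

Lemma hclass_eq0 i (x : cocycles K i) : (hclass x == 0) = (val x \in coboundaries K i).
Proof.
rewrite -[X in _ == X](raddf0 (@hclass i)) hclass_eq.
by have -> : val (0 : cocycles K i) = 0 by []; rewrite subr0.
Qed.

Lemma cocycleP i (x : cocycles K i) : cdif K i (val x) = 0.
Proof. by apply/eqP; have := valP x; rewrite inE. Qed.

End CohomologyClass.

Section CohomologyMap.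
Variables (K L : precomplex) (phi : forall i, {additive cobj K i -> cobj L i}).
Hypothesis phid : forall i x, phi i.+1 (cdif K i x) = cdif L i (phi i x).

Lemma cocycle_map_proof i (z : cocycles K i) : phi i (val z) \in ker_sub (cdif L i).
Proof. by rewrite inE -phid cocycleP raddf0. Qed.

Definition cocycle_map i (z : cocycles K i) : cocycles L i :=
  Sub (phi i (val z)) (cocycle_map_proof z) : subm (ker_sub (cdif L i)).

Lemma coboundaries_map i x : x \in coboundaries K i -> phi i x \in coboundaries L i.
Proof.
case: i x => [|i] x; first by rewrite !inE => /eqP ->; rewrite raddf0.
by rewrite !inE => /asboolP[y ->]; apply/asboolP; exists (phi i y); rewrite phid.
Qed.

Definition cohomology_map i (h : cohomology K i) : cohomology L i :=
  hclass (cocycle_map (repr h)).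

Lemma cohomology_map_class i (z : cocycles K i) :
  cohomology_map (hclass z) = hclass (cocycle_map z).
Proof.
apply/eqP; rewrite hclass_eq /= -raddfB; apply: coboundaries_map.
by rewrite -hclass_eq hclass_repr.
Qed.

Lemma cohomology_map_additive i : zmod_morphism (@cohomology_map i).
Proof.
move=> x y; rewrite -[x]hclass_repr -[y]hclass_repr -raddfB !cohomology_map_class.
by rewrite -raddfB; congr hclass; apply: val_inj; rewrite /= !raddfB.
Qed.

HB.instance Definition _ i := GRing.isZmodMorphism.Build (cohomology K i) (cohomology L i)
  (@cohomology_map i) (@cohomology_map_additive i).

Lemma cohomology_map_degree i : degree_preserving (@cgr K i) (@cgr L i) (phi i) ->
  degree_preserving (@cohomology_gr K i) (@cohomology_gr L i) (@cohomology_map i).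
Proof.
move=> phig a b _ /asboolP[z zg ->]; rewrite inE; apply/asboolP.
exists (cocycle_map z); last exact: cohomology_map_class.
by rewrite inE; apply: phig; move: zg; rewrite inE.
Qed.

End CohomologyMap.

(** The degreewise inverses of a chain isomorphism commute with the differentials, so they induce
    the inverse map on cohomology. *)
Lemma complex_iso_cohomology (K L : precomplex) : complex_iso K L ->
  forall i, bigraded_isomorphic (@cohomology_gr K i) (@cohomology_gr L i).
Proof.
case=> phi [phig phid] i.
have [psi psiP] : exists psi : forall i, {additive cobj L i -> cobj K i}, forall i,
    [/\ cancel (phi i) (psi i), cancel (psi i) (phi i)
      & degree_preserving (@cgr L i) (@cgr K i) (psi i)].
  by exists (fun i => projT1 (cid (bigraded_iso_inv (phig i)))) => j; case: cid.
have psid j x : psi j.+1 (cdif L j x) = cdif K j (psi j x).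
  have [phiK psiK _] := psiP j.+1; apply: (can_inj phiK).
  by rewrite psiK phid; case: (psiP j) => _ ->.
exists (@cohomology_map K L phi phid i).
apply: (@bigraded_iso_can _ _ _ _ _ (@cohomology_map L K psi psid i)).
- move=> h; rewrite -[h]hclass_repr /= !cohomology_map_class; congr hclass.
  by apply: val_inj; case: (psiP i) => phiK _ _; rewrite /= phiK.
- move=> h; rewrite -[h]hclass_repr /= !cohomology_map_class; congr hclass.
  by apply: val_inj; case: (psiP i) => _ psiK _; rewrite /= psiK.
- by apply: cohomology_map_degree => a b x xg; case: (phig i) => _ ->.
- by apply: cohomology_map_degree; case: (psiP i).
Qed.

Lemma has_rank_inj (M N : zmodType) (f : {additive M -> N})
  (S : zmodClosed M) (T : zmodClosed N) n : injective f ->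
  (forall y, y \in T <-> exists2 x, x \in S & y = f x) -> has_rank T n -> has_rank S n.
Proof.
move=> fI TE [w [wT wI wQ]].
have /choice[v vP] k : exists x, x \in S /\ w k = f x.
  by have /TE[x Sx wE] := wT k; exists x.
have fsum c : f (\sum_k v k *~ c k) = \sum_k w k *~ c k.
  by rewrite raddf_sum; apply: eq_bigr => k _; rewrite raddfMz; case: (vP k) => _ <-.
exists v; split=> [k|c c0|x Sx]; first by case: (vP k).
  by apply: wI; rewrite -fsum c0 raddf0.
have [|m m0 [c cE]] := wQ (f x); first by apply/TE; exists x.
by exists m => //; exists c; apply: fI; rewrite fsum raddfMz.
Qed.

Lemma has_rank0 (M : zmodType) (S : zmodClosed M) : (forall x, x \in S -> x = 0) -> has_rank S 0.
Proof.
move=> S0; exists (fun=> 0); split=> [[]//|c _ []//|x /S0 ->].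
by exists 1 => //; exists (fun=> 0); rewrite big_ord0 mulr1z.
Qed.

(** * Euler characteristic, one bidegree at a time *)

Section EulerCharacteristic.
Variables (K : precomplex) (KP : bigraded_complex K).

Definition homog_coboundaries i a b : zmodClosed (cobj K i) :=
  match i with
  | 0 => @zero_sub (cobj K 0)
  | i'.+1 => dirim_sub (cdif K i') (@cgr K i' a b)
  end.

(** The differential commutes with the graded projections, so if y is any primitive of a homogeneous
    coboundary, the component [p a b y] is a primitive as well. *)
Lemma homog_coboundariesE i a b x : x \in homog_coboundaries i a b <->
  x \in @cgr K i a b /\ x \in coboundaries K i.
Proof.
have [Kg Kd _] := KP; case: i x => [|i] x.
  by split=> [|[]//]; rewrite !inE => /eqP ->; rewrite rpred0.
rewrite /= !inE; split=> [/asboolP[y yg ->]|[xg /asboolP[y xE]]].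
  by split; [exact: Kd | apply/asboolP; exists y].
apply/asboolP; have [p [pg pid p0]] := is_bigraded_proj (Kg i).
have [p' [_ pid' p0']] := is_bigraded_proj (Kg i.+1).
exists (p a b y); first exact: pg.
rewrite -(pid' _ _ _ xg) xE; move: {x xg xE} (is_bigraded_gen (Kg i) y); move: y.
apply: span_ind => [|y z hy hz|y [k [l yg]]]; first by rewrite !raddf0.
  by rewrite !raddfB hy hz.
have := Kd i k l y yg; have [/andP[/eqP <- /eqP <-]|] := boolP ((k == a) && (l == b)).
  by move=> dyg; rewrite (pid' _ _ _ dyg) (pid _ _ _ yg).
by move=> /negbTE nkl dyg; rewrite (p0' _ _ _ _ _ dyg nkl) (p0 _ _ _ _ _ yg nkl) raddf0.
Qed.

(** Here [r i] is the rank of the coboundaries and [h i] that of cohomology. Rank-nullity for the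
    differential splits [c i] into cocycles and [r i.+1]; for the class map it splits the cocycles
    into [r i] and [h i]. *)
Lemma cohomology_rank (c : nat -> nat) a b :
  (forall i, has_rank (@cgr K i a b) (c i)) ->
  exists r h : nat -> nat, [/\ r 0%N = 0%N,
    forall i, has_rank (@cohomology_gr K i a b) (h i)
    & forall i, c i = (h i + r i + r i.+1)%N].
Proof.
move=> cP; have [_ _ dd0] := KP.
pose Z i : zmodClosed (cobj K i) :=
  dirim_sub (val : cocycles K i -> cobj K i) (subm_gr (ker_sub (cdif K i)) (@cgr K i) a b).
have ZE i x : x \in Z i <-> x \in @cgr K i a b /\ cdif K i x = 0.
  rewrite inE; split=> [/asboolP[z]|[xg x0]].
    by rewrite inE => zg ->; split=> //; exact: cocycleP.
  have xk : x \in ker_sub (cdif K i) by rewrite inE x0.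
  by apply/asboolP; exists (Sub x xk : subm (ker_sub (cdif K i))) => //; rewrite inE.
have /choice[zr zrP] i : exists zr : nat * nat, [/\ has_rank (Z i) zr.1,
    has_rank (homog_coboundaries i.+1 a b) zr.2 & c i = (zr.1 + zr.2)%N].
  have [|m [k [mP kP ck]]] := @rank_nullity _ _ (cdif K i) _ (Z i)
    (homog_coboundaries i.+1 a b) _ (cP i) (ZE i); last by exists (m, k).
  by move=> y; rewrite inE; split=> [/asboolP|h]; last exact/asboolP.
pose r i := if i is i'.+1 then (zr i').2 else 0%N.
have rP i : has_rank (homog_coboundaries i a b) (r i).
  case: i => [|i] /=; last by case: (zrP i).
  by apply: has_rank0 => x; rewrite inE => /eqP.
have valB i : zmod_morphism (val : cocycles K i -> cobj K i) by move=> x y; rewrite raddfB.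
have /choice[h hP] i : exists h, has_rank (@cohomology_gr K i a b) h /\ (zr i).1 = (r i + h)%N.
  have Zc : has_rank (subm_gr (ker_sub (cdif K i)) (@cgr K i) a b) (zr i).1.
    apply: (@has_rank_inj _ _ (zadd (valB i)) _ (Z i)) val_inj _ _; last by case: (zrP i).
    by move=> y; rewrite inE; split=> [/asboolP|hy]; last exact/asboolP.
  have [|/=|m [k [mP kP ck]]] := @rank_nullity _ _ (@hclass K i) _
    (preim_sub (val : cocycles K i -> cobj K i) (homog_coboundaries i a b))
    (@cohomology_gr K i a b) _ Zc.
  - move=> z; rewrite !inE; split=> [/homog_coboundariesE[zg zb]|[zg /eqP]].
      by split=> //; apply/eqP; rewrite hclass_eq0.
    by rewrite hclass_eq0 => zb; apply/homog_coboundariesE.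
  - by move=> y; rewrite inE; split=> [/asboolP|hy]; last exact/asboolP.
  exists k; split=> //; rewrite ck; congr (_ + _)%N.
  apply: has_rank_uniq mP _.
  apply: (@has_rank_inj _ _ (zadd (valB i)) _ (homog_coboundaries i a b)) val_inj _ (rP i).
  move=> y; split=> [yb|[z]]; last by rewrite inE => zb ->.
  have yk : y \in ker_sub (cdif K i).
    have /homog_coboundariesE[_] := yb; rewrite inE; case: (i) (y) => [|j] x.
      by rewrite inE => /eqP ->; rewrite raddf0.
    by rewrite inE => /asboolP[w ->]; rewrite dd0.
  by exists (Sub y yk : subm (ker_sub (cdif K i))) => //; rewrite inE.
exists r, h; split=> // [i|i]; first by case: (hP i).
have [_ _ ->] := zrP i; have [_ ->] := hP i.
by rewrite [(r i + _)%N]addnC.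
Qed.

(** The coboundary ranks telescope; [r 0] vanishes, and only the term at the upper end is left. *)
Lemma alternating_sum (c h r : nat -> nat) n : r 0%N = 0%N ->
  (forall i, c i = (h i + r i + r i.+1)%N) ->
  \sum_(i < n) (-1) ^+ i * (h i)%:Z =
  \sum_(i < n) (-1) ^+ i * (c i)%:Z + (-1) ^+ n * (r n)%:Z.
Proof.
move=> r0 cE; elim: n => [|n IH]; first by rewrite !big_ord0 r0 mulr0.
rewrite !big_ord_recr /= IH cE !PoszD exprS !mulrDr mulN1r mulNr.
by rewrite [X in _ = X + _]addrA addrK -addrA [X in _ + X]addrC.
Qed.

Lemma fcoef_sign i (u : fps (fps int)) a b :
  fcoef (fcoef ((-1) ^+ i * u) a) b = (-1) ^+ i * fcoef (fcoef u a) b.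
Proof.
by rewrite -signr_odd -[in RHS]signr_odd; case: (odd i);
  rewrite ?expr1 ?expr0 ?mul1r // !mulN1r.
Qed.

Lemma euler_characteristic n : (forall i, qfinite (@cgr K i)) ->
  (forall x : cobj K n, x = 0) ->
  (forall i, qfinite (@cohomology_gr K i)) /\
  \sum_(i < n) (-1) ^+ i * qdim (@cohomology_gr K i) =
    \sum_(i < n) (-1) ^+ i * qdim (@cgr K i).
Proof.
move=> fin Kn0; pose c a b i := Defs.dim (rationalization (subm (@cgr K i a b))).
have cP a b i : has_rank (@cgr K i a b) (c a b i).
  by apply/has_rankE; rewrite /c; have [m mP] := fin i a b; rewrite (dimE mP).
split=> [i a b|].
  have [r [h [_ hP _]]] := cohomology_rank (cP a b).
  by exists (h i); apply/has_rankE.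
apply: fpsP => a; apply: fpsP => b; rewrite !fcoef_sum.
have [r [h [r0 hP cE]]] := cohomology_rank (cP a b).
rewrite (eq_bigr (fun i : 'I_n => (-1) ^+ i * (h i)%:Z)) => [|i _]; last first.
  by rewrite fcoef_sign /= (dimE (proj1 (has_rankE _ _) (hP i))).
rewrite [RHS](eq_bigr (fun i : 'I_n => (-1) ^+ i * (c a b i)%:Z)) => [|i _]; last first.
  by rewrite fcoef_sign.
rewrite (alternating_sum n r0 cE).
(* The leftover term vanishes because [r n] is at most the rank of the chain group in degree [n],
   which is zero. *)
have : c a b n = 0%N.
  by apply: has_rank_uniq (cP a b n) _; apply: has_rank0 => x _; exact: Kn0.
rewrite cE => /eqP; rewrite !addn_eq0 => /andP[/andP[_ /eqP ->] _].
by rewrite mulr0 addr0.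
Qed.

End EulerCharacteristic.

(** The state sum is sorted by the number of edges, and substituting [QA - 1] and [QB - 1] cancels
    the shifts by 1 in [That]. *)
Lemma That_qdim (G : mgraph) n (QA QB : fps (fps int)) : #|edge G| = n ->
  \sum_(i < n.+1) (-1) ^+ i * \sum_(s : states G i) QA ^+ b0 (val s) * QB ^+ b1 (val s) =
  That G (QA - 1) (QB - 1).
Proof.
move=> Gn; rewrite /That; have cn (s : {set edge G}) : (#|s| < n.+1)%N by rewrite ltnS -Gn max_card.
rewrite [RHS](partition_big (fun s => Ordinal (cn s)) predT) //=; apply: eq_bigr => i _.
rewrite mulr_sumr [RHS](reindex_omap (val : states G i -> _) insub) /=.
  apply: eq_big => [s|s _]; first by rewrite valK eqxx andbT -(inj_eq val_inj) /= (valP s).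
  by rewrite (eqP (valP s)) mulrA ![1 + _]addrC !subrK.
by move=> s /eqP/(congr1 val) /= si; rewrite insubT ?si.
Qed.

Theorem theorem4p1
  (A : comPzRingType) (gA : bigrading A)
  (B : zmodType) (gB : bigrading B)
  (f : forall k : nat, {additive tpow 'I_k B -> tpow 'I_k.+1 B})
  (hA : is_bigraded_ring gA) (hB : is_bigraded gB)
  (finA : qfinite gA) (finB : qfinite gB)
  (hf : forall k, degree_preserving (tpow_gr 'I_k gB) (tpow_gr 'I_k.+1 gB) (f k))
  (G : mgraph) (n : nat) (e : 'I_n -> edge G) (he : bijective e) :
  let C := tutte_complex gA gB f e in
  (* (a) *)
  (bigraded_complex C /\
   (forall i, (n < i)%N -> forall x : cobj C i, x = 0)) /\
  (* (b) *)
  ((forall e' : 'I_n -> edge G, bijective e' ->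
      forall i, bigraded_isomorphic (@cohomology_gr C i)
                  (@cohomology_gr (tutte_complex gA gB f e') i)) /\
   (forall (G' : mgraph) (e' : 'I_n -> edge G'), bijective e' -> mgraph_iso G G' ->
      (forall i, bigraded_isomorphic (@cohomology_gr C i)
                   (@cohomology_gr (tutte_complex gA gB f e') i)) /\
      complex_iso C (tutte_complex gA gB f e'))) /\
  (* (c) *)
  ((forall i, qfinite (@cgr C i) /\ qfinite (@cohomology_gr C i)) /\
   \sum_(i < n.+1) (-1) ^+ i * qdim (@cohomology_gr C i) =
     \sum_(i < n.+1) (-1) ^+ i * qdim (@cgr C i) /\
   \sum_(i < n.+1) (-1) ^+ i * qdim (@cgr C i) =
     That G (qdim gA - 1) (qdim gB - 1)).
Proof.
move=> C; case: (he) => d eK dK.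
have Gn : #|edge G| = n by rewrite -(bij_eq_card he) card_ord.
have chainQ i := @chain_has_qdim A gA B gB hA G i _ _
  (qfinite_has_qdim (proj1 hA) finA) (qfinite_has_qdim hB finB).
have Cb : bigraded_complex C.
  split=> [i|i|i x]; first by case: (chainQ i).
    exact: (differential_degree hA hf eK dK).
  exact: (differential_square f eK dK).
have C0 i : (n < i)%N -> forall x : cobj C i, x = 0.
  (* No edge set has more than [n] elements, so this direct sum has no summands. *)
  move=> ni x; apply: functional_extensionality_dep => s.
  by have := max_card (val s); rewrite (eqP (valP s)) Gn leqNgt ni.
have isoC (G' : mgraph) (e' : 'I_n -> edge G') : bijective e' -> mgraph_iso G G' ->
    complex_iso C (tutte_complex gA gB f e').
  move=> [d' e'K d'K] [phi [psi [[phi' phiK phi'K] [psi' psiK psi'K] inc]]].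
  have inc' := incidence_preserving_inv phiK psi'K inc.
  (* Counts the pairs of edges whose order under [e] is reversed by that of their images under
     [e']. *)
  pose eps := inversions (fun a => d a : nat) (fun a => d' (psi a) : nat).
  exists (fun i => @chain_image G G' phi psi A B eps i
    : {additive chain A B G i -> chain A B G' i}).
  split=> [i|i x].
    apply: (@bigraded_iso_can _ _ _ _ _ (@chain_image G' G phi' psi' A B
      (fun r => eps (psi' @: r)) i : {additive chain A B G' i -> chain A B G i})).
    - exact: (chain_image_cancel phiK psiK psi'K inc eps).
    - have := @chain_image_cancel _ _ _ _ _ _ phi'K psi'K psiK inc' A B
        (fun r => eps (psi' @: r)) i.
      (* The cancellation lemma used backwards transports the sign function forth and back, which
         gives [eps] again. *)
      have -> // : (fun r : {set edge G} => eps (psi' @: (psi @: r))) = eps.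
      by apply/funext => r; rewrite (imset_edgeK psiK).
    - exact: (chain_image_degree phi'K inc hA eps).
    - exact: (chain_image_degree phiK inc' hA).
  exact: (chain_image_differential phiK psiK psi'K inc f eK dK e'K d'K).
split; first by split.
split; first split.
- move=> e' he' i; apply: complex_iso_cohomology; apply: isoC => //.
  by exists id, id; split; [exists id | exists id | left].
- move=> G' e' he' iso; have := isoC G' e' he' iso.
  by split=> //; exact: complex_iso_cohomology.
have finC i : qfinite (@cgr C i) by have [] := has_qdimE (chainQ i).
(* The sums run over degrees 0 to n, so the vanishing group needed at the upper end is the one in
   degree [n.+1]. *)
have [finH euler] := euler_characteristic Cb finC (C0 _ (ltnSn n)).
split; first by [].
split=> //; rewrite -(That_qdim _ _ Gn); apply: eq_bigr => i _; congr (_ * _).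
by have [] := has_qdimE (chainQ i).
Qed.
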